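(* Let $K$ be a finite extension of $K_0=\mathbb{F}_q(T)$, let $\phi$ be a Drinfeld module (of rank $r\geqslant1$) defined over $K$, and let $G,H\in\mathtt{SG}_K(\phi)$. For any infinite place $v$ of $K$, we have $$h_{\mathrm{Tag},K}^v\big(\phi/(G\cap H)\big)+h_{\mathrm{Tag},K}^v\big(\phi/(G+H)\big)=h_{\mathrm{Tag},K}^v(\phi/G)+h_{\mathrm{Tag},K}^v(\phi/H).$$
   Context: Notation. $\mathbb{F}_q$ is a finite field with $q$ elements, $A=\mathbb{F}_q[T]$, $K_0=\mathbb{F}_q(T)$, and $K/K_0$ is a finite field extension. $K\{\tau\}$ is the ring of twisted polynomials $\sum_i f_i\tau^i$ ($f_i\in K$) with $\tau c=c^q\tau$ for $c\in K$; to $f=\sum_{i=0}^d f_i\tau^i$ one associates the polynomial $f(x)=\sum_i f_i x^{q^i}\in K[x]$. $f$ is normalized if its constant coefficient $f_0$ is $1$, and, if $f_0\neq0$, $\ker(f)$ is the set of roots of $f(x)$ in $\overline K$. Drinfeld modules. A Drinfeld module of rank $r\geqslant1$ over $K$ (or over any field extension of $K_0$) is an $\mathbb{F}_q$-algebra homomorphism $\phi:A\to K\{\tau\}$, $a\mapsto\phi_a$, such that for every $a\in A$ the constant coefficient of $\phi_a$ is $a$, and $\deg_\tau\phi_a=r\deg_T a$. An isogeny $f:\phi\to\psi$ is a nonzero $f\in K\{\tau\}$ with $f\cdot\phi_a=\psi_a\cdot f$ for all $a\in A$. $\mathtt{SG}_K(\phi)$ is the set of finite dimensional $\mathbb{F}_q$-subspaces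 $G$ of the separable closure $K^{\mathrm{sep}}$ which are stable under $\mathrm{Gal}(K^{\mathrm{sep}}/K)$ and satisfy $\phi_a(G)\subseteq G$ for all $a\in A$; it is closed under intersection and sum. For $G\in\mathtt{SG}_K(\phi)$ there are a unique Drinfeld module $\phi/G$ over $K$ and a unique normalized isogeny $f_G:\phi\to\phi/G$ over $K$ with $\ker(f_G)=G$. Places. The place $\infty$ of $K_0$ is the one with $\mathrm{ord}_\infty(a)=-\deg a$ for $a\in A$. A place of $K$ is infinite if it lies above $\infty$. $K_v$ is the completion of $K$ at $v$. Lattices. $\mathbb{C}_\infty$ is the completion of an algebraic closure of the completion $K_{0,\infty}$, with normalized absolute value $|x|_\infty=q^{-\mathrm{ord}_\infty(x)}$ ($\mathrm{ord}_\infty$ extended to $\mathbb{C}_\infty$). An $A$-lattice is a finitely generated $A$-submodule $\Lambda\subset\mathbb{C}_\infty$ which is discrete (finite intersection with every ball); its rank is its $A$-rank. A successive minimum basis of a rank $r$ lattice $\Lambda$ is an $A$-basis $(\eta_1,\dots,\eta_r)$ with $|\eta_1|_\infty\geqslant\dots\geqslant|\eta_r|_\infty$ such that, for each $k$, $\eta_k$ has minimal absolute value among the elements of $\Lambda\smallsetminus(A\eta_{k+1}+\dots+A\eta_r)$ (for $k=r$: among nonzero elements of $\Lambda$). Such a basis exists and the tuple of absolute values depends only on $\Lambda$; the covolume is $\mathcal{D}(\Lambda)=|\eta_1|_\infty\cdots|\eta_r|_\infty$. Put $e_\Lambda(z)=z\prod_{\lambda\in\Lambda\smallsetminus\{0\}}(1-z/\lambda)$.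 Every Drinfeld module $\phi$ of rank $r$ over $\mathbb{C}_\infty$ has a unique associated $A$-lattice $\Lambda_\phi$ of rank $r$, characterized by $\phi_a(e_{\Lambda_\phi}(z))=e_{\Lambda_\phi}(az)$ for all $a\in A$, $z\in\mathbb{C}_\infty$. Local Taguchi height at an infinite place. For a Drinfeld module $\phi$ of rank $r$ over $K$ and $v$ infinite, let $\Lambda_{\phi,v}$ be the lattice of the Drinfeld module over $\mathbb{C}_\infty$ obtained from $\phi$ via the inclusion $K\hookrightarrow K_v\hookrightarrow\mathbb{C}_\infty$, and set $h_{\mathrm{Tag},K}^v(\phi)=\log_q\big(\mathcal{D}(\Lambda_{\phi,v})^{-1/r}\big)$. *)

(* Defs.v *)
From HB Require Import structures.
From mathcomp Require Import all_boot all_order all_algebra.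
From mathcomp Require Import all_fingroup all_solvable all_field.
From mathcomp Require Import generic_quotient.
From mathcomp Require Import finmap zify.
From mathcomp Require Import boolp classical_sets cardinality reals exp.
Set Implicit Arguments.
Unset Strict Implicit.
Unset Printing Implicit Defensive.
Import Order.TTheory GRing.Theory Num.Theory.
Local Open Scope classical_set_scope.
Local Open Scope ring_scope.

Notation "x %:F" := (@FracField.tofrac _ x) : ring_scope.


(* [skewpoly s] is the ring of polynomials in tau with coefficients on the
   left and tau * c = s c * tau; its underlying group is that of {poly L}, the
   coefficient of tau^i being the coefficient of 'X^i. *)
Section SkewPoly.
Variables (L : fieldType) (s : {rmorphism L -> L}).
Implicit Types p q t : {poly L}.

Definition tau_mul p : {poly L} := 'X * map_poly s p.

Definition skew_mul p q : {poly L} :=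
  \sum_(i < size p) p`_i *: iter i tau_mul q.

Lemma tau_mul_zmod : zmod_morphism tau_mul.
Proof. by move=> p q; rewrite /tau_mul raddfB mulrBr. Qed.
HB.instance Definition _ :=
  GRing.isZmodMorphism.Build {poly L} {poly L} tau_mul tau_mul_zmod.

Lemma tau_mulZ c p : tau_mul (c *: p) = s c *: tau_mul p.
Proof. by rewrite /tau_mul map_polyZ -scalerAr. Qed.

Lemma coef_tau_mul p i : (tau_mul p)`_i = if i is j.+1 then s p`_j else 0.
Proof. by rewrite /tau_mul coefXM; case: i => //= i; rewrite coef_map. Qed.

Lemma size_tau_mul p : (size (tau_mul p) <= (size p).+1)%N.
Proof.
by rewrite (leq_trans (size_polyMleq _ _)) // size_polyX size_map_poly.
Qed.

Lemma iter_tauB i p q :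
  iter i tau_mul (p - q) = iter i tau_mul p - iter i tau_mul q.
Proof. by elim: i => //= i ->; rewrite raddfB. Qed.

Lemma skew_mul_wide n p q : (size p <= n)%N ->
  skew_mul p q = \sum_(i < n) p`_i *: iter i tau_mul q.
Proof.
move=> le_pn.
rewrite /skew_mul (big_ord_widen n (fun i => p`_i *: iter i tau_mul q)) //.
rewrite big_mkcond /=; apply: eq_bigr => i _.
by case: ltnP => // le_pi; rewrite nth_default ?scale0r.
Qed.

Lemma skew_mulDl : left_distributive skew_mul +%R.
Proof.
move=> p q t; set n := maxn (size p) (size q).
have le_pn : (size p <= n)%N by rewrite leq_maxl.
have le_qn : (size q <= n)%N by rewrite leq_maxr.
rewrite !(@skew_mul_wide n) ?size_polyD //.
by rewrite -big_split; apply: eq_bigr => i _; rewrite coefD scalerDl.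
Qed.

Lemma skew_mulBr p : zmod_morphism (skew_mul p).
Proof.
move=> q t; rewrite /skew_mul -sumrB.
by apply: eq_bigr => i _; rewrite iter_tauB scalerBr.
Qed.
HB.instance Definition _ p :=
  GRing.isZmodMorphism.Build {poly L} {poly L} (skew_mul p) (skew_mulBr p).

Lemma skew_mulDr : right_distributive skew_mul +%R.
Proof. by move=> p q t; rewrite raddfD. Qed.

Lemma skew_mulZl c p q : skew_mul (c *: p) q = c *: skew_mul p q.
Proof.
rewrite !(@skew_mul_wide (size p)) ?size_scale_leq // scaler_sumr.
by apply: eq_bigr => i _; rewrite coefZ scalerA.
Qed.

Lemma skew_mul_tau p q : skew_mul (tau_mul p) q = tau_mul (skew_mul p q).
Proof.
rewrite (skew_mul_wide _ (size_tau_mul p)) big_ord_recl coef_tau_mul scale0r.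
rewrite add0r /skew_mul raddf_sum; apply: eq_bigr => i _.
by rewrite coef_tau_mul /= tau_mulZ.
Qed.

Lemma skew_mul_iter_tau i p q :
  skew_mul (iter i tau_mul p) q = iter i tau_mul (skew_mul p q).
Proof. by elim: i => //= i IHi; rewrite skew_mul_tau IHi. Qed.

Lemma skew_mul0l q : skew_mul 0 q = 0.
Proof. by rewrite /skew_mul size_poly0 big_ord0. Qed.

Lemma skew_mulA : associative skew_mul.
Proof.
move=> p q t; apply/esym; rewrite {2}/skew_mul.
rewrite (big_morph (skew_mul^~ t) (fun x y => skew_mulDl x y t) (skew_mul0l t)).
by apply: eq_bigr => i _; rewrite skew_mulZl skew_mul_iter_tau.
Qed.

Lemma skew_mul1l : left_id 1 skew_mul.
Proof. by move=> p; rewrite /skew_mul size_poly1 big_ord1 coef1 scale1r. Qed.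

Lemma iter_tau1 i : iter i tau_mul 1 = 'X^i.
Proof. by elim: i => //= i ->; rewrite /tau_mul map_polyXn -exprS. Qed.

Lemma skew_mul1r : right_id 1 skew_mul.
Proof.
move=> p; rewrite -[RHS]coefK poly_def.
by apply: eq_bigr => i _; rewrite iter_tau1.
Qed.

Definition skewpoly of {rmorphism L -> L} : Type := {poly L}.
HB.instance Definition _ := GRing.Zmodule.copy (skewpoly s) {poly L}.
HB.instance Definition _ := GRing.Zmodule_isNzRing.Build (skewpoly s)
  skew_mulA skew_mul1l skew_mul1r skew_mulDl skew_mulDr (oner_neq0 {poly L}).

End SkewPoly.

(* The structure of extension of F_q(T) on L is the field morphism [kappa]; it
   also gives the embeddings of F_q and F_q[T] in L. *)
Section TwistedPolynomials.
Variables (F : finFieldType) (L : fieldType).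
Implicit Type kappa : {rmorphism {fraction {poly F}} -> L}.

Definition frobq kappa (x : L) : L := x ^+ #|F|.

Lemma card_pcharL kappa : [pchar L].-nat #|F|.
Proof.
have [p p_pr pF] := finPcharP F.
have pL : p \in [pchar L].
  exact: (rmorph_pchar (kappa \o @FracField.tofrac _ \o polyC) pF).
rewrite (eq_pnat _ (pcharf_eq pL)).
have := abelem_pgroup (fin_ring_pchar_abelem pF).
by rewrite /pgroup cardsT.
Qed.

Lemma frobq_zmod kappa : zmod_morphism (frobq kappa).
Proof.
move=> x y; have charL := card_pcharL kappa.
by rewrite /frobq exprDn_pchar // exprNn_pchar.
Qed.

Lemma frobq_monoid kappa : monoid_morphism (frobq kappa).
Proof. by split=> [|x y]; rewrite /frobq ?expr1n ?exprMn. Qed.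

HB.instance Definition _ kappa :=
  GRing.isZmodMorphism.Build L L (frobq kappa) (frobq_zmod kappa).
HB.instance Definition _ kappa :=
  GRing.isMonoidMorphism.Build L L (frobq kappa) (frobq_monoid kappa).

Definition A_emb kappa (a : {poly F}) : L := kappa a%:F.

Definition twpoly kappa := skewpoly (frobq kappa).
HB.instance Definition _ kappa := GRing.NzRing.on (twpoly kappa).

Definition tw_poly kappa (f : twpoly kappa) : {poly L} := f.

Definition qpoly kappa (f : twpoly kappa) : {poly L} :=
  \sum_(i < size (tw_poly f)) (tw_poly f)`_i *: 'X^(#|F| ^ i).

Definition tw_normalized kappa (f : twpoly kappa) := (tw_poly f)`_0 = 1.

End TwistedPolynomials.


Record drinfeld (F : finFieldType) (L : fieldType)
    (kappa : {rmorphism {fraction {poly F}} -> L}) (r : nat) := Drinfeld {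
  drinfeld_mor :> {rmorphism {poly F} -> twpoly kappa};
  drinfeld_lin : forall (c : F) (a : {poly F}),
    tw_poly (drinfeld_mor (c *: a)) =
      A_emb kappa c%:P *: tw_poly (drinfeld_mor a);
  drinfeld_const : forall a, (tw_poly (drinfeld_mor a))`_0 = A_emb kappa a;
  drinfeld_deg : forall a, a != 0 ->
    size (tw_poly (drinfeld_mor a)) = (r * (size a).-1).+1
}.

Section Isogenies.
Variables (F : finFieldType) (L : fieldType).
Variables (kappa : {rmorphism {fraction {poly F}} -> L}) (r : nat).

Definition isogeny (phi psi : drinfeld kappa r) (f : twpoly kappa) :=
  f != 0 /\ forall a, f * phi a = psi a * f.

End Isogenies.

Section BaseChange.
Variables (F : finFieldType) (L M : fieldType).
Variables (kappa : {rmorphism {fraction {poly F}} -> L}).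
Variables (mu : {rmorphism {fraction {poly F}} -> M}).
Variables (iota : {rmorphism L -> M}).
Hypothesis iotaE : forall x, iota (kappa x) = mu x.

Definition tw_map (f : twpoly kappa) : twpoly mu := map_poly iota (tw_poly f).

Lemma tw_map_zmod : zmod_morphism tw_map.
Proof. exact: (raddfB (map_poly iota)). Qed.

Lemma tw_map_tau i (f : {poly L}) :
  map_poly iota (iter i (tau_mul (frobq kappa)) f)
  = iter i (tau_mul (frobq mu)) (map_poly iota f).
Proof.
elim: i => //= i <-; set g := iter _ _ _; apply/polyP=> j.
rewrite coef_map !coef_tau_mul; case: j => [|j]; first exact: (rmorph0 iota).
by rewrite coef_map /= /frobq rmorphXn.
Qed.

Lemma tw_map_monoid : monoid_morphism tw_map.
Proof.
split=> [|f g]; first exact: (rmorph1 (map_poly iota)).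
rewrite /tw_map /tw_poly [LHS](raddf_sum (map_poly iota)).
rewrite [RHS](@skew_mul_wide _ _ (size (tw_poly f))) ?size_map_poly //.
by apply: eq_bigr => i _; rewrite /= map_polyZ tw_map_tau coef_map.
Qed.

HB.instance Definition _ :=
  GRing.isZmodMorphism.Build (twpoly kappa) (twpoly mu) tw_map tw_map_zmod.
HB.instance Definition _ :=
  GRing.isMonoidMorphism.Build (twpoly kappa) (twpoly mu) tw_map tw_map_monoid.

Variables (r : nat) (phi : drinfeld kappa r).

Lemma base_change_lin (c : F) (a : {poly F}) :
  tw_poly ((tw_map \o phi) (c *: a)) =
    A_emb mu c%:P *: tw_poly ((tw_map \o phi) a).
Proof.
rewrite /= /tw_map [X in map_poly _ X]drinfeld_lin /tw_poly map_polyZ.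
by rewrite /A_emb /= iotaE.
Qed.

Lemma base_change_const a : (tw_poly ((tw_map \o phi) a))`_0 = A_emb mu a.
Proof. by rewrite /= coef_map /= drinfeld_const /A_emb iotaE. Qed.

Lemma base_change_deg a : a != 0 ->
  size (tw_poly ((tw_map \o phi) a)) = (r * (size a).-1).+1.
Proof. by move=> a0; rewrite /= size_map_poly drinfeld_deg. Qed.

Definition base_change : drinfeld mu r :=
  Drinfeld base_change_lin base_change_const base_change_deg.

End BaseChange.


Record alg_closure (L : fieldType) := AlgClosure {
  ac_field :> closedFieldType;
  ac_emb : {rmorphism L -> ac_field};
  ac_algebraic : forall x, algebraicOver ac_emb x
}.

Definition separable_over (L E : fieldType) (i : {rmorphism L -> E}) (x : E) :=
  exists2 p : {poly L}, separable_poly p & root (map_poly i p) x.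

Record sep_closure (L : fieldType) (Lbar : alg_closure L) := SepClosure {
  sc_field :> fieldType;
  sc_emb : {rmorphism L -> sc_field};
  sc_incl : {rmorphism sc_field -> Lbar};
  sc_inclE : forall x, sc_incl (sc_emb x) = ac_emb Lbar x;
  sc_range : forall y : Lbar,
    separable_over (ac_emb Lbar) y <-> exists x, sc_incl x = y
}.


Section Quotients.
Variables (F : finFieldType) (L : fieldType).
Variables (kappa : {rmorphism {fraction {poly F}} -> L}) (r : nat).
Variables (Lbar : alg_closure L) (Lsep : sep_closure Lbar).
Implicit Types (phi psi : drinfeld kappa r) (G H : set Lsep).

Definition fin_dim_subspace G := exists n (b : 'I_n -> Lsep),
  G = [set x | exists c : 'I_n -> F,
         x = \sum_(i < n) sc_emb Lsep (A_emb kappa (c i)%:P) * b i].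

Definition galois_stable G := forall s : {rmorphism Lsep -> Lsep},
  bijective s -> (forall x, s (sc_emb Lsep x) = sc_emb Lsep x) ->
  forall g, G g -> G (s g).

Definition SG phi G := [/\ fin_dim_subspace G, galois_stable G &
  forall a g, G g -> G (map_poly (sc_emb Lsep) (qpoly (phi a))).[g] ].

(* [psi] is phi/G, i.e. the target of a normalized isogeny with kernel G; the
   kernel is the set of roots in the algebraic closure. *)
Definition is_quotient phi G psi := exists f : twpoly kappa,
  [/\ isogeny phi psi f, tw_normalized f &
      [set y : Lbar | root (map_poly (ac_emb Lbar) (qpoly f)) y]
        = sc_incl Lsep @` G].

Definition set_sum G H : set Lsep := [set g + h | g in G & h in H].

End Quotients.


Section AbsoluteValues.
Variable R : realType.

Definition absolute_value (L : fieldType) (a : L -> R) :=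
  [/\ forall x, 0 <= a x, forall x, (a x == 0) = (x == 0),
      {morph a : x y / x * y}
    & forall x y, a (x + y) <= Num.max (a x) (a y)].

Definition abs_cauchy (L : fieldType) (a : L -> R) (u : nat -> L) :=
  forall e, 0 < e -> exists N, forall m n, (N <= m)%N -> (N <= n)%N ->
    a (u m - u n) < e.

Definition abs_cvg (L : fieldType) (a : L -> R) (u : nat -> L) (l : L) :=
  forall e, 0 < e -> exists N, forall n, (N <= n)%N -> a (u n - l) < e.

Record completion (L : fieldType) (a : L -> R) := Completion {
  cpl_field :> fieldType;
  cpl_abs : cpl_field -> R;
  cpl_absP : absolute_value cpl_abs;
  cpl_emb : {rmorphism L -> cpl_field};
  cpl_absE : forall x, cpl_abs (cpl_emb x) = a x;
  cpl_dense : forall y e, 0 < e -> exists x, cpl_abs (y - cpl_emb x) < e;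
  cpl_complete : forall u, abs_cauchy cpl_abs u -> exists l, abs_cvg cpl_abs u l
}.

End AbsoluteValues.


Section Infinity.
Variables (R : realType) (F : finFieldType).
Local Notation K0 := {fraction {poly F}}.

(* ord_infty (a / b) = deg b - deg a, junk value at 0 *)
Definition ord_infty (x : K0) : int :=
  (size (\d_(repr x)))%:Z - (size (\n_(repr x)))%:Z.

Lemma ord_inftyE (a b : {poly F}) : a != 0 -> b != 0 ->
  ord_infty (a%:F / b%:F) = (size b)%:Z - (size a)%:Z.
Proof.
move=> a0 b0; rewrite /ord_infty; set y := _ / _; set x := repr y.
have d0 : \d_x != 0 by apply: denom_ratioP.
have yE : y * (\d_x)%:F = (\n_x)%:F.
  rewrite -[y]reprK -/x; unlock FracField.tofrac; rewrite -[LHS]FracField.pi_mul.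
  apply/eqmodP; rewrite /= FracField.equivfE /FracField.mulf.
  by rewrite !numden_Ratio ?oner_neq0 ?mulr1 ?d0 // mulrC.
have /eqP : a%:F * (\d_x)%:F = (\n_x)%:F * b%:F.
  by rewrite -yE /y mulrAC divfK // tofrac_eq0.
rewrite -!tofracM tofrac_eq => /eqP nd.
have n0 : \n_x != 0.
  by apply: contraNneq (mulf_neq0 a0 d0) => n0; rewrite nd n0 mul0r.
have := congr1 (size \o polyseq) nd; rewrite /= !size_mul //.
move: a0 b0 d0 n0; rewrite -!size_poly_gt0.
move: (size (polyseq a)) (size (polyseq b)).
move: (size (polyseq \d_x)) (size (polyseq \n_x)) => m n k l.
lia.
Qed.

Definition abs_infty (x : K0) : R :=
  if x == 0 then 0 else #|F|%:R ^ (- ord_infty x).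

(* C_infty is the completion of an algebraic closure of the completion of
   F_q(T) at infinity, for the absolute value extending abs_infty. *)
Record C_infty := CInfty {
  ci_K0inf : completion abs_infty;
  ci_K0bar : alg_closure ci_K0inf;
  ci_K0bar_abs : ci_K0bar -> R;
  ci_K0bar_absP : absolute_value ci_K0bar_abs;
  ci_K0bar_absE : forall x, ci_K0bar_abs (ac_emb ci_K0bar x) = cpl_abs x;
  ci_field :> completion ci_K0bar_abs
}.

Definition ci_emb (C : C_infty) : {rmorphism K0 -> C} :=
  cpl_emb C \o ac_emb (ci_K0bar C) \o cpl_emb (ci_K0inf C).

Definition ci_abs (C : C_infty) : C -> R := @cpl_abs _ _ _ C.

(* Places of a finite extension K of F_q(T) are given by their normalized
   discrete valuations, whose value at 0 is junk. *)
Record place (K : fieldExtType K0) := Place {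
  ord_place :> K -> int;
  ord_placeM : forall x y, x != 0 -> y != 0 ->
    ord_place (x * y) = ord_place x + ord_place y;
  ord_placeD : forall x y, x != 0 -> y != 0 -> x + y != 0 ->
    Num.min (ord_place x) (ord_place y) <= ord_place (x + y);
  ord_place_surj : exists2 x, x != 0 & ord_place x = 1
}.

(* v lies above infinity, with ramification index e *)
Definition infinite_place (K : fieldExtType K0) (v : place K) :=
  exists2 e : nat, (0 < e)%N &
    forall x : K0, x != 0 -> v (in_alg K x) = e%:Z * ord_infty x.

(* This absolute value is that of infinity raised to the power e on F_q(T); it
   is only used to define the completion K_v, for which the choice of a power
   is immaterial. *)
Definition abs_place (K : fieldExtType K0) (v : place K) (x : K) : R :=
  if x == 0 then 0 else #|F|%:R ^ (- v x).

(* an inclusion of K_v in C_infty, continuous and compatible with that of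
   F_q(T) *)
Record Kv_inclusion (K : fieldExtType K0) (v : place K)
    (Kv : completion (abs_place v)) (C : C_infty) := KvInclusion {
  kvi_mor :> {rmorphism Kv -> C};
  kvi_K0 : forall x : K0, kvi_mor (cpl_emb Kv (in_alg K x)) = ci_emb C x;
  kvi_cont : forall e, 0 < e -> exists2 d, 0 < d &
    forall x, cpl_abs x < d -> ci_abs (kvi_mor x) < e
}.

Definition K_inclusion (K : fieldExtType K0) (v : place K)
    (Kv : completion (abs_place v)) (C : C_infty) (j : Kv_inclusion Kv C) :
  {rmorphism K -> C} := j \o cpl_emb Kv.


Section Lattices.
Variable C : C_infty.
Implicit Types (Lambda : set C) (r : nat).

Definition A_span n (P : pred 'I_n) (b : 'I_n -> C) : set C :=
  [set x | exists c : 'I_n -> {poly F},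
     x = \sum_(i < n | P i) A_emb (ci_emb C) (c i) * b i].

Definition A_free n (b : 'I_n -> C) := forall c : 'I_n -> {poly F},
  \sum_(i < n) A_emb (ci_emb C) (c i) * b i = 0 -> forall i, c i = 0.

Definition A_basis Lambda n (b : 'I_n -> C) :=
  A_free b /\ Lambda = A_span xpredT b.

Definition A_lattice Lambda :=
  (exists n (b : 'I_n -> C), Lambda = A_span xpredT b) /\
  (forall rho : R, finite_set (Lambda `&` [set x | ci_abs x <= rho])).

Definition A_rank Lambda r :=
  (exists b : 'I_r -> C, (forall i, Lambda (b i)) /\ A_free b) /\
  (forall b : 'I_r.+1 -> C, (forall i, Lambda (b i)) -> ~ A_free b).

Definition succ_min_basis Lambda r (eta : 'I_r -> C) :=
  [/\ A_basis Lambda eta,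
      forall i j : 'I_r, (i <= j)%N -> ci_abs (eta j) <= ci_abs (eta i)
    & forall (k : 'I_r) x,
        Lambda x -> ~ A_span (fun j : 'I_r => (k < j)%N) eta x ->
        ci_abs (eta k) <= ci_abs x].

(* The product does not depend on the successive minimum basis, and such a
   basis exists for every lattice. *)
Definition covolume Lambda : R :=
  xget 0 [set d | exists r (eta : 'I_r -> C),
    succ_min_basis Lambda eta /\ d = \prod_(i < r) ci_abs (eta i)].

(* The infinite product e_Lambda(z), as the limit of the products over finite
   subsets of Lambda \ {0}. *)
Definition exp_lattice Lambda (z : C) : C :=
  xget 0 [set w | forall e, 0 < e -> exists2 S0 : {fset C},
    [set` S0] `<=` Lambda `\ 0 &
    forall S : {fset C}, (S0 `<=` S)%fset -> [set` S] `<=` Lambda `\ 0 ->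
      ci_abs (z * (\prod_(l <- S) (1 - z / l)) - w) < e].

Definition associated_lattice r (phi : drinfeld (ci_emb C) r) Lambda :=
  [/\ A_lattice Lambda, A_rank Lambda r &
      forall a z, (qpoly (phi a)).[exp_lattice Lambda z]
                  = exp_lattice Lambda (A_emb (ci_emb C) a * z)].

End Lattices.

Definition log_q (x : R) : R := ln x / ln #|F|%:R.


(* [h] is the height of phi at v, computed with the lattice associated to phi
   (which exists and is unique by analytic uniformization). *)
Definition taguchi_height (K : fieldExtType K0) (v : place K)
    (Kv : completion (abs_place v)) (C : C_infty) (j : Kv_inclusion Kv C)
    r (phi : drinfeld (in_alg K) r) (h : R) :=
  exists2 Lambda : set C,
    associated_lattice (base_change (iota := K_inclusion j) (kvi_K0 j) phi) Lambda
    & h = log_q (covolume Lambda `^ (- (1 / r%:R))).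

End Infinity.

(* Main.v *)
From Pilot Require Import Defs.
From HB Require Import structures.
From mathcomp Require Import all_boot all_order all_algebra all_field.
From mathcomp Require Import finmap zify ring lra.
From mathcomp Require Import boolp classical_sets cardinality reals exp.
(* mathcomp.algebra has its own [qpoly] *)
Import Pilot.Defs.
Set Implicit Arguments.
Unset Strict Implicit.
Unset Printing Implicit Defensive.
Import Order.TTheory GRing.Theory Num.Theory.
Local Open Scope classical_set_scope.
Local Open Scope ring_scope.

(* Each of phi/G, phi/H and phi/(G+H) is the target of a normalized isogeny g
   from phi/(G cap H), and counting kernels in the algebraic closure shows that
   the tau-degrees of these isogenies add up. It therefore suffices that a
   normalized isogeny of tau-degree d divides the covolume by q^d.
   Let f : phi -> psi be such an isogeny, with lattices L and L'. The defect
   d(z) = f(e_L(z)) - e_L'(z) is O(z^2) at 0 and satisfies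
   d(Tz) = psi_T(d(z)), whence d = 0 by iteration. As e_L has kernel L, its
   fibres give #(L' cap B) <= q^d #(L cap B) for every ball B around 0. An
   isogeny h with h f = phi_a gives in the same way
   #(L cap aB) <= q^(deg h) #(L' cap B), and since #(L cap aB) =
   |a|^r #(L cap B) for large B, both inequalities are equalities. Finally a
   successive minimum basis is orthogonal, so that the number of points of L in
   large balls determines its covolume. *)

(** * Twisted polynomials *)

(** The comparison starts from phi/(G cap H) because lattices are given for the four quotients only;
    one for phi would have to be constructed by analytic uniformization. The defect vanishes because
    of a gain in each division of z by T: psi_T enlarges small values by a factor q at most, whereas
    a quadratic bound shrinks by q^2. A merely linear bound would gain nothing, and it is the
    normalization of f that cancels the linear terms. The fibre argument uses the kernel of the
    exponential but not its surjectivity, so it bounds lattice points from above only. The matching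
    lower bound is the same argument for an isogeny in the opposite direction, the two tau-degrees
    adding up to r deg a. Absolute values of lattice vectors need not be integral powers of q, so a
    single ball sees their logarithms only after rounding. For this reason the counts are made for
    all radii q^(l/M) with M arbitrary. *)

Section SkewDivision.
Variables (L : fieldType) (s : {rmorphism L -> L}).
Implicit Types p q : {poly L}.

Lemma size_iter_tau_mul i p :
  p != 0 -> size (iter i (tau_mul s) p) = (size p + i)%N.
Proof.
move=> p0; elim: i => [|i IHi] /=; first by rewrite addn0.
have nz : iter i (tau_mul s) p != 0.
  by rewrite -size_poly_gt0 IHi ltn_addr // size_poly_gt0.
by rewrite /tau_mul mulrC size_mulX ?map_poly_eq0 // size_map_poly IHi addnS.
Qed.

Lemma lead_coef_iter_tau_mul i p :
  lead_coef (iter i (tau_mul s) p) = iter i s (lead_coef p).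
Proof.
elim: i => //= i <-.
by rewrite /tau_mul mulrC lead_coef_Mmonic ?monicX // lead_coef_map.
Qed.

Lemma size_skew_mul p q : p != 0 -> q != 0 ->
  size (skew_mul s p q) = (size p + size q).-1.
Proof.
move=> p0 q0; rewrite /skew_mul.
case sp: (size p) => [|n]; first by rewrite -size_poly_eq0 sp in p0.
have lp : p`_n != 0 by move: p0; rewrite -lead_coef_eq0 lead_coefE sp.
rewrite big_ord_recr /= addrC size_polyDl size_scale // size_iter_tau_mul //.
  by rewrite addnC.
apply: (leq_ltn_trans (size_sum _ _ _)).
rewrite (@leq_ltn_trans (size q + n).-1) //; last first.
  by rewrite prednK // addn_gt0 size_poly_gt0 q0.
apply/bigmax_leqP => i _; rewrite (leq_trans (size_scale_leq _ _)) //.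
rewrite size_iter_tau_mul //; have := ltn_ord i; lia.
Qed.

Lemma skew_mulI p q : q != 0 -> skew_mul s p q = 0 -> p = 0.
Proof.
move=> q0 pq0; apply/eqP/negP => /negP p0.
have := size_skew_mul p0 q0; rewrite pq0 size_poly0.
by move: p0 q0; rewrite -!size_poly_gt0; lia.
Qed.

(** With the divisor on the right, tau^k moves past its leading coefficient as s^k, which is
    injective. The leading term of p is thus cancelled by a division in L, without inverting s, so L
    may be imperfect. *)
Lemma skew_division p q : q != 0 ->
  exists g t, p = skew_mul s g q + t /\ (size t < size q)%N.
Proof.
move=> q0; have [n] := ubnP (size p); elim: n p => // n IHn p /ltnSE le_pn.
have [lt_pq|le_qp] := ltnP (size p) (size q).
  by exists 0, p; rewrite skew_mul0l add0r.
set k := (size p - size q)%N.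
set c := lead_coef p / iter k s (lead_coef q).
set m := c *: iter k (tau_mul s) q.
have lq : iter k s (lead_coef q) != 0.
  by rewrite -lead_coef_iter_tau_mul lead_coef_eq0 -size_poly_gt0
    size_iter_tau_mul // ltn_addr // size_poly_gt0.
have sq : (0 < size q)%N by rewrite size_poly_gt0.
have p0 : p != 0 by rewrite -size_poly_gt0 (leq_trans sq).
have c0 : c != 0 by rewrite mulf_neq0 ?invr_eq0 // lead_coef_eq0.
have sm : size m = size p by rewrite size_scale // size_iter_tau_mul // subnKC.
have lm : lead_coef m = lead_coef p.
  by rewrite lead_coefZ lead_coef_iter_tau_mul divfK.
have /IHn [g [t [pE lt_t]]] : (size (p - m)%R < n)%N.
  apply: leq_trans le_pn.
  have: (size (p - m)%R <= size p)%N.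
    by rewrite (leq_trans (size_polyD _ _)) // size_polyN sm maxnn.
  rewrite leq_eqVlt => /orP[/eqP sE|//].
  have: lead_coef (p - m) = 0.
    by rewrite lead_coefE sE coefB -lead_coefE -lm lead_coefE sm subrr.
  by move/eqP; rewrite lead_coef_eq0 -size_poly_eq0 sE size_poly_eq0 (negPf p0).
exists (g + c *: 'X^k), t; split=> //.
rewrite skew_mulDl skew_mulZl -(iter_tau1 s) skew_mul_iter_tau skew_mul1l.
by rewrite addrAC -pE subrK.
Qed.

End SkewDivision.

Section QPoly.
Variables (F : finFieldType) (L : fieldType).
Variable (kappa : {rmorphism {fraction {poly F}} -> L}).
Implicit Types (f g : twpoly kappa).
Local Notation q := #|F|.

Let q_gt1 : (1 < q)%N := finNzRing_gt1 F.

Lemma qpoly_wide n f : (size (tw_poly f) <= n)%N ->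
  qpoly f = \sum_(i < n) (tw_poly f)`_i *: 'X^(q ^ i).
Proof.
move=> le_fn; rewrite /qpoly.
rewrite (big_ord_widen n (fun i => (tw_poly f)`_i *: 'X^(q ^ i))) //.
rewrite big_mkcond /=; apply: eq_bigr => i _.
by case: ltnP => // le; rewrite nth_default ?scale0r.
Qed.

Lemma horner_qpoly f x :
  (qpoly f).[x] = \sum_(i < size (tw_poly f)) (tw_poly f)`_i * x ^+ (q ^ i).
Proof.
by rewrite /qpoly horner_sum; apply: eq_bigr => i _; rewrite hornerZ hornerXn.
Qed.

Lemma horner_qpoly_wide n f x : (size (tw_poly f) <= n)%N ->
  (qpoly f).[x] = \sum_(i < n) (tw_poly f)`_i * x ^+ (q ^ i).
Proof.
move=> /qpoly_wide ->; rewrite horner_sum.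
by apply: eq_bigr => i _; rewrite hornerZ hornerXn.
Qed.

Lemma horner_qpolyD f g x : (qpoly (f + g)).[x] = (qpoly f).[x] + (qpoly g).[x].
Proof.
set n := maxn (size (tw_poly f)) (size (tw_poly g)).
rewrite !(@horner_qpoly_wide n) ?leq_maxl ?leq_maxr //; last exact: size_polyD.
by rewrite -big_split; apply: eq_bigr => i _; rewrite /= -mulrDl -coefD.
Qed.

Lemma horner_qpolyN f x : (qpoly (- f)).[x] = - (qpoly f).[x].
Proof.
rewrite !horner_qpoly [tw_poly _]/(- tw_poly f) size_polyN -sumrN.
by apply: eq_bigr => i _; rewrite coefN mulNr.
Qed.

Lemma horner_qpolyB f g x : (qpoly (f - g)).[x] = (qpoly f).[x] - (qpoly g).[x].
Proof. by rewrite horner_qpolyD horner_qpolyN. Qed.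

Lemma iter_frobq i x : x ^+ (q ^ i) = iter i (frobq kappa) x.
Proof.
elim: i => [|i IHi] /=; first by rewrite expr1.
by rewrite -IHi /frobq -exprM -expnSr.
Qed.

Lemma expr_qB i (x y : L) : (x - y) ^+ (q ^ i) = x ^+ (q ^ i) - y ^+ (q ^ i).
Proof. by rewrite !iter_frobq; elim: i => //= i ->; rewrite rmorphB. Qed.

Lemma qpolyB f x y : (qpoly f).[x - y] = (qpoly f).[x] - (qpoly f).[y].
Proof.
rewrite !horner_qpoly -sumrB; apply: eq_bigr => i _.
by rewrite expr_qB mulrBr.
Qed.

Lemma qpoly0r f : (qpoly f).[0] = 0.
Proof. by have := qpolyB f 0 0; rewrite !subrr. Qed.

Lemma horner_qpoly_iter_tau i (p : {poly L}) x :
  (qpoly (iter i (tau_mul (frobq kappa)) p : twpoly kappa)).[x]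
  = (qpoly (p : twpoly kappa)).[x] ^+ (q ^ i).
Proof.
elim: i => [|i IHi]; first by rewrite expr1.
set g := iter i.+1 _ _; rewrite expnSr exprM -IHi.
set h := iter i _ _; have ->: g = tau_mul (frobq kappa) h by [].
rewrite (horner_qpoly_wide x (size_tau_mul (frobq kappa) h)).
rewrite big_ord_recl coef_tau_mul mul0r add0r horner_qpoly.
rewrite -[_ ^+ q]/(frobq kappa _) rmorph_sum; apply: eq_bigr => j _.
by rewrite rmorphM coef_tau_mul /= /frobq -exprM -expnSr.
Qed.

Lemma horner_qpolyZ c (p : {poly L}) x :
  (qpoly (c *: p : twpoly kappa)).[x] = c * (qpoly (p : twpoly kappa)).[x].
Proof.
rewrite (@horner_qpoly_wide (size p)) ?size_scale_leq // horner_qpoly mulr_sumr.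
by apply: eq_bigr => i _; rewrite coefZ mulrA.
Qed.

Lemma horner_qpoly_comp f g x : (qpoly (f * g)).[x] = (qpoly f).[(qpoly g).[x]].
Proof.
rewrite [in RHS]horner_qpoly.
have ->: f * g = skew_mul (frobq kappa) (tw_poly f) (tw_poly g) by [].
rewrite /skew_mul.
pose ev (p : {poly L}) := (qpoly (p : twpoly kappa)).[x].
have ev0 : ev 0 = 0 by rewrite /ev horner_qpoly size_poly0 big_ord0.
rewrite -[LHS]/(ev _) (big_morph ev (fun p r => horner_qpolyD p r x) ev0).
by apply: eq_bigr => i _; rewrite /ev horner_qpolyZ horner_qpoly_iter_tau.
Qed.

Lemma size_qpoly f : f != 0 -> size (qpoly f) = (q ^ (size (tw_poly f)).-1).+1.
Proof.
rewrite -[f == 0]/(tw_poly f == 0) => f0; rewrite /qpoly.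
case sf: (size (tw_poly f)) => [|n]; first by rewrite -size_poly_eq0 sf in f0.
have lf : (tw_poly f)`_n != 0 by move: f0; rewrite -lead_coef_eq0 lead_coefE sf.
rewrite big_ord_recr /= addrC size_polyDl size_scale ?size_polyXn //.
rewrite ltnS; apply: (leq_trans (size_sum _ _ _)).
apply/bigmax_leqP => i _; rewrite (leq_trans (size_scale_leq _ _)) //.
by rewrite size_polyXn ltn_exp2l.
Qed.

Lemma qpoly_neq0 f : f != 0 -> qpoly f != 0.
Proof. by move=> f0; rewrite -size_poly_gt0 size_qpoly. Qed.

Lemma card_natr0 : q%:R = 0 :> L.
Proof.
have charL := card_pcharL kappa.
have [p p_pr pF] := finPcharP F.
have pL : p \in [pchar L].
  exact: (rmorph_pchar (kappa \o @FracField.tofrac _ \o polyC) pF).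
apply/eqP; rewrite -(dvdn_pcharf pL).
move: charL q_gt1; rewrite (eq_pnat _ (pcharf_eq pL)) => /p_natP [[|k] ->] //.
by rewrite dvdn_exp.
Qed.

Lemma deriv_qpoly f : (qpoly f)^`() = ((tw_poly f)`_0)%:P.
Proof.
rewrite /qpoly; have [->|] := eqVneq (tw_poly f) 0.
  by rewrite size_poly0 big_ord0 coef0 deriv0.
rewrite -size_poly_gt0; case: (size _) => // n _.
rewrite big_ord_recl derivD derivZ expn0 derivX raddf_sum big1 => [|i _].
  by rewrite addr0 alg_polyC.
rewrite /= derivZ derivXn -scaler_nat /bump /= expnS natrM.
by rewrite card_natr0 mul0r scale0r scaler0.
Qed.

Lemma separable_qpoly f : (tw_poly f)`_0 != 0 -> separable_poly (qpoly f).
Proof.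
move=> f0; rewrite separable_poly.unlock deriv_qpoly.
by rewrite coprimep_sym -alg_polyC coprimepZl ?coprime1p.
Qed.

End QPoly.

Section QPolyMap.
Variables (F : finFieldType) (L M : fieldType).
Variable (kappa : {rmorphism {fraction {poly F}} -> L}).
Variable (mu : {rmorphism {fraction {poly F}} -> M}).
Variable (iota : {rmorphism L -> M}).
Implicit Types (f g : twpoly kappa).

Lemma size_tw_map f : size (tw_poly (tw_map mu iota f)) = size (tw_poly f).
Proof. exact: size_map_poly. Qed.

Lemma map_qpoly f : map_poly iota (qpoly f) = qpoly (tw_map mu iota f).
Proof.
rewrite /qpoly size_tw_map raddf_sum; apply: eq_bigr => i _.
by rewrite /= map_polyZ map_polyXn coef_map.
Qed.

Lemma tw_map_eq0 f : (tw_map mu iota f == 0) = (f == 0).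
Proof. exact: map_poly_eq0. Qed.

End QPolyMap.

Section Kernels.
Variables (F : finFieldType) (L : fieldType) (M : closedFieldType).
Variable (kappa : {rmorphism {fraction {poly F}} -> L}).
Variable (iota : {rmorphism L -> M}).
Implicit Types (f g h : twpoly kappa).
Local Notation q := #|F|.

(** A nonzero constant coefficient makes the derivative of f(x) a nonzero constant, so all roots are
    simple. Kernels are handled as duplicate-free lists so that they can be counted. *)
Lemma tw_kernelP f : (tw_poly f)`_0 != 0 -> exists rs : seq M,
  [/\ uniq rs, size rs = (q ^ (size (tw_poly f)).-1)%N &
      forall x, (x \in rs) = root (map_poly iota (qpoly f)) x].
Proof.
move=> f0; have nz : f != 0.
  by apply: contraNneq f0 => ->; rewrite /tw_poly coef0.
have [rs E] := closed_field_poly_normal (map_poly iota (qpoly f)).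
have lc : lead_coef (map_poly iota (qpoly f)) != 0.
  by rewrite lead_coef_eq0 map_poly_eq0 qpoly_neq0.
have uq : uniq rs.
  have : separable_poly (map_poly iota (qpoly f)).
    by rewrite separable_map separable_qpoly.
  by rewrite E (eqp_separable (eqp_scale _ lc)) separable_prod_XsubC.
exists rs; split=> // [|x].
  have := size_map_poly iota (qpoly f); rewrite E size_scale //.
  by rewrite size_prod_XsubC size_qpoly // => -[].
by rewrite E rootZ // root_prod_XsubC.
Qed.

(** The remainder of f modulo h vanishes on the whole kernel of h, which has more elements than the
    degree of its q-polynomial allows unless the remainder is zero. *)
Lemma tw_kernel_divides f h : (tw_poly h)`_0 != 0 ->
  (forall x, root (map_poly iota (qpoly h)) x ->
             root (map_poly iota (qpoly f)) x) ->
  exists g, f = g * h.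
Proof.
move=> h0 hf; have nz : h != 0.
  by apply: contraNneq h0 => ->; rewrite /tw_poly coef0.
have [g [t [E lt_t]]] : exists g t : twpoly kappa, f = g * h + t /\
    (size (tw_poly t) < size (tw_poly h))%N.
  exact: (skew_division (frobq kappa) f nz).
exists g; suff t0 : t = 0 by rewrite t0 addr0 in E.
have [rs [uq sz inR]] := tw_kernelP h0.
apply/eqP/negPn/negP => tn0.
have : (size rs < size (map_poly iota (qpoly t)))%N.
  apply: max_poly_roots => //; first by rewrite map_poly_eq0 qpoly_neq0.
  apply/allP => x; rewrite inR => rx; have := hf _ rx.
  pose mu : {rmorphism _ -> _} := iota \o kappa.
  move: rx; rewrite !(map_qpoly mu) E rmorphD rmorphM /=.
  rewrite /root horner_qpolyD horner_qpoly_comp => /eqP ->.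
  by rewrite qpoly0r add0r.
rewrite size_map_poly size_qpoly // ltnS sz leqNgt ltn_exp2l ?finNzRing_gt1 //.
have : (0 < size (tw_poly t))%N by rewrite size_poly_gt0.
by lia.
Qed.

End Kernels.

(** * Factorization of isogenies *)

Lemma size_sum_fibers (T U : eqType) (h : T -> U) (X : seq T) (Y : seq U) :
  uniq Y -> {in X, forall x, h x \in Y} ->
  size X = (\sum_(y <- Y) count (fun x => h x == y) X)%N.
Proof.
move=> uY hXY; rewrite -sum1_size.
under [RHS]eq_bigr do rewrite -sum1_count big_mkcond.
rewrite exchange_big; apply: eq_big_seq => x /hXY hx.
rewrite (bigD1_seq _ hx uY) /= eqxx big1 // => y; rewrite eq_sym.
by move/negPf ->.
Qed.

Lemma size_fibers_leq (T U : eqType) (h : T -> U) k (X : seq T) (Y : seq U) :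
  uniq Y -> {in X, forall x, h x \in Y} ->
  {in Y, forall y, count (fun x => h x == y) X <= k}%N -> (size X <= k * size Y)%N.
Proof.
move=> uY hXY hk; rewrite (size_sum_fibers uY hXY) -sum1_size big_distrr /=.
by rewrite big_seq [leqRHS]big_seq; apply: leq_sum => y /hk; rewrite muln1.
Qed.

(** Addition maps the pairs from A and B onto S, and its fibre through (a, b) consists of the pairs
    (a + c, b - c) with c in the intersection. *)
Lemma size_cap_sum (V : zmodType) (A B C S : seq V) :
  uniq A -> uniq B -> uniq C -> uniq S ->
  {in A &, forall x y, x - y \in A} -> {in B &, forall x y, x - y \in B} ->
  (forall x, x \in C <-> x \in A /\ x \in B) ->
  (forall x, x \in S <-> exists a b, [/\ a \in A, b \in B & x = a + b]) ->
  (size C * size S = size A * size B)%N.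
Proof.
move=> uA uB uC uS AB BB inC inS.
have A0 a : a \in A -> 0 \in A by move=> aA; rewrite -(subrr a) AB.
have B0 b : b \in B -> 0 \in B by move=> bB; rewrite -(subrr b) BB.
have AD a c : a \in A -> c \in A -> a + c \in A.
  by move=> aA cA; rewrite -[c]opprK AB // -sub0r AB // (A0 a).
pose X := [seq (a, b) | a <- A, b <- B].
rewrite -(size_allpairs pair A B) -/X.
rewrite (@size_sum_fibers _ _ (fun z => z.1 + z.2) X S) //; last first.
  by move=> _ /allpairsP[[a b] [aA bB ->]] /=; apply/inS; exists a, b.
rewrite -[size S]sum1_size big_distrr /= big_seq [RHS]big_seq.
apply: eq_bigr => s /inS [a [b [aA bB ->]]]; rewrite muln1 -size_filter.
rewrite -(size_map (fun c => (a + c, b - c)) C).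
apply: perm_size; apply: uniq_perm.
- by rewrite map_inj_uniq // => c d [/addrI].
- by rewrite filter_uniq // allpairs_uniq // => -[? ?] [? ?].
move=> [x y]; rewrite mem_filter /=; apply/mapP/andP => [[c /inC[cA cB] [-> ->]]|].
  by rewrite addrACA subrr addr0; split=> //; apply: allpairs_f; rewrite ?AD ?BB.
move=> [/eqP xy /allpairsP[[x' y'] /= [xA yB [? ?]]]]; subst x' y'.
have E : x - a = b - y.
  by apply/eqP; rewrite subr_eq addrAC [b + a]addrC -xy addrK.
exists (x - a); last by rewrite addrC subrK E subKr.
by apply/inC; split; [exact: AB | rewrite E; exact: BB].
Qed.

Section Isogenies.
Variables (F : finFieldType) (L : fieldType).
Variable (kappa : {rmorphism {fraction {poly F}} -> L}).
Implicit Types (f g h : twpoly kappa).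
Local Notation q := #|F|.

Lemma size_tw_mul f g : f != 0 -> g != 0 ->
  size (tw_poly (f * g)) = (size (tw_poly f) + size (tw_poly g)).-1.
Proof. exact: size_skew_mul. Qed.

Lemma tw_mulIf f g h : h != 0 -> f * h = g * h -> f = g.
Proof.
move=> h0 E; apply/eqP; rewrite -subr_eq0; apply/eqP.
apply: (skew_mulI (s := frobq kappa) h0).
by apply: (etrans (mulrBl h f g)); rewrite E subrr.
Qed.

Lemma coef0_tw_mul f g :
  (tw_poly (f * g))`_0 = (tw_poly f)`_0 * (tw_poly g)`_0.
Proof.
have -> : tw_poly (f * g) = skew_mul (frobq kappa) (tw_poly f) (tw_poly g) by [].
rewrite (@skew_mul_wide _ _ (size (tw_poly f)).+1) // big_ord_recl /=.
rewrite coefD coefZ coef_sum big1 ?addr0 // => i _.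
by rewrite coefZ coef_tau_mul mulr0.
Qed.

Lemma tw_normalized_coef0 f : tw_normalized f -> (tw_poly f)`_0 != 0.
Proof. by move=> ->; apply: oner_neq0. Qed.

Lemma tw_normalized_neq0 f : tw_normalized f -> f != 0.
Proof.
by move=> f1; apply/eqP => f0; have /eqP := f1; rewrite f0 coef0 eq_sym oner_eq0.
Qed.

Variable (r : nat).
Implicit Types (phi psi : drinfeld kappa r).

Lemma isogeny_factor phi phi1 phi2 f1 f2 g :
  isogeny phi phi1 f1 -> isogeny phi phi2 f2 ->
  tw_normalized f1 -> tw_normalized f2 -> f2 = g * f1 ->
  isogeny phi1 phi2 g /\ tw_normalized g.
Proof.
move=> [nz1 E1] [nz2 E2] f10 f20 fE.
have g0 : tw_normalized g.
  have := f20; rewrite /tw_normalized fE coef0_tw_mul f10.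
  by rewrite mulr1.
split=> //; split=> [|a]; first exact: tw_normalized_neq0.
by apply: (tw_mulIf nz1); rewrite -!mulrA -E1 !mulrA -fE E2 -mulrA fE.
Qed.

End Isogenies.

Section DualIsogeny.
Variables (F : finFieldType) (L : fieldType) (M : closedFieldType).
Variable (kappa : {rmorphism {fraction {poly F}} -> L}).
Variable (iota : {rmorphism L -> M}) (r : nat).
Implicit Types (f g h : twpoly kappa) (phi psi : drinfeld kappa r).

(** The finite kernel of f is stable under phi, so by the pigeonhole principle two distinct powers
    of T act on it in the same way. Their difference a kills the kernel, and f then divides phi_a on
    the right. *)
Lemma isogeny_dual phi psi f : isogeny phi psi f -> tw_normalized f ->
  exists a h, a != 0 /\ phi a = h * f.
Proof.
move=> [nz fE] f1; have f0 : (tw_poly f)`_0 != 0 by rewrite f1 oner_neq0.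
have [rs [uq _ inR]] := tw_kernelP iota f0.
pose mu : {rmorphism _ -> _} := iota \o kappa.
pose ev (a : {poly F}) x := (qpoly (tw_map mu iota (phi a))).[x].
have evR a x : x \in rs -> ev a x \in rs.
  rewrite !inR (map_qpoly mu) /root /ev -horner_qpoly_comp -rmorphM fE rmorphM.
  by rewrite horner_qpoly_comp => /eqP ->; rewrite qpoly0r.
have evB a b x : ev (a - b) x = ev a x - ev b x.
  by rewrite /ev !rmorphB horner_qpolyB.
(* Self-maps of the kernel are recorded by positions in [rs], to live in a finite type. The
   successor in the codomain is there for [inord]; the positions that occur are all below
   [size rs]. *)
pose T := {ffun 'I_(size rs) -> 'I_(size rs).+1}.
pose act n : T := [ffun i : 'I__ => inord (index (ev 'X^n rs`_i) rs)].
have [m [n [mn E]]] : exists m n : nat, m != n /\ act m = act n.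
  have : ~ injective (fun i : 'I_(#|T|.+1) => act i).
    by move/leq_card; rewrite card_ord ltnn.
  move/existsNP => [i /existsNP [k /not_implyP [E ik]]].
  by exists i, k; split=> //; apply/eqP => ?; apply/ik/val_inj.
have a0 : 'X^m - 'X^n != 0 :> {poly F}.
  rewrite subr_eq0; apply: contra_neq mn => /(congr1 (size \o polyseq)) /=.
  by rewrite !size_polyXn => -[].
exists ('X^m - 'X^n).
suff [h ->] : exists h, phi ('X^m - 'X^n) = h * f by exists h.
apply: (tw_kernel_divides (iota := iota) f0) => x; rewrite -inR => xR.
rewrite (map_qpoly mu) /root -/(ev _ _) evB subr_eq0.
have := congr1 (fun g : T => g (Ordinal (etrans (index_mem x rs) xR))) E.
rewrite !ffunE /= nth_index // => /(congr1 val) /=.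
rewrite !inordK ?ltnS ?index_size // => /(congr1 (nth 0 rs)).
by rewrite !nth_index ?evR // => ->.
Qed.

End DualIsogeny.

(** * Non-archimedean absolute values *)

(** Put P(x) for the product of the x - w. Then P(x + y) - P(x) - P(y) as a polynomial in x has
    degree less than the number of elements of W, since the leading terms cancel, and it vanishes on
    W, since translation by an element of W permutes W. *)
Lemma prod_subgroupB (L : fieldType) (W : seq L) :
  uniq W -> 0 \in W -> {in W &, forall x y, x - y \in W} ->
  forall x y, \prod_(w <- W) (x - y - w) =
    \prod_(w <- W) (x - w) - \prod_(w <- W) (y - w).
Proof.
move=> uW W0 WB.
pose p y : {poly L} := \prod_(w <- [seq w - y | w <- W]) ('X - w%:P).
have pE y x : (p y).[x] = \prod_(w <- W) (x + y - w).
  rewrite horner_prod big_map; apply: eq_bigr => w _.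
  by rewrite hornerXsubC; ring.
have sp y : size (p y) = (size W).+1 by rewrite size_prod_XsubC size_map.
have mp y : p y \is monic by exact: monic_prod_XsubC.
have pW w y : w \in W -> (p y).[w] = (p y).[0].
  move=> wW; rewrite !pE add0r.
  rewrite [RHS](perm_big (map (fun v => v - w) W)) /=; last first.
    apply: uniq_perm => //; first by rewrite map_inj_uniq // => u v /addIr.
    move=> v; apply/idP/mapP => [vW|[u uW' ->]]; last exact: WB.
    exists (v + w); last by rewrite addrK.
    by rewrite -[w]opprK WB // -sub0r WB.
  rewrite big_map; by apply: eq_bigr => v _; ring.
have pD y x : (p y).[x] = (p 0).[x] + (p y).[0].
  pose D := p y - p 0 - ((p y).[0])%:P.
  suff D0 : D = 0.
    have := congr1 (horner^~ x) D0; rewrite !hornerE => /eqP.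
    by rewrite -addrA -opprD subr_eq0 => /eqP.
  apply: (@roots_geq_poly_eq0 _ _ W) => //.
    have p00 : (p 0).[0] = 0.
      by rewrite pE (big_rem 0) //= addr0 subr0 mul0r.
    apply/allP => w wW; rewrite /root !hornerE (pW _ y) // (pW _ 0) //.
    by rewrite p00 subr0 subrr.
  have W1 : (0 < size W)%N by case: (W) W0.
  rewrite (leq_trans (size_polyD _ _)) // size_polyN geq_max.
  rewrite (leq_trans (size_polyC_leq1 _)) // andbT.
  apply/leq_sizeP => i; rewrite leq_eqVlt coefB => /orP[/eqP <-|lt].
    have := monicP (mp y); have := monicP (mp 0).
    by rewrite !lead_coefE !sp => -> ->; rewrite subrr.
  by rewrite !nth_default ?sp ?subrr.
move=> x y; have := pD y (x - y); rewrite !pE !addr0 add0r subrK => ->.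
by rewrite addrK.
Qed.

Section AbsoluteValue.
Variables (R : realType) (L : fieldType) (a : L -> R).
Hypothesis aP : absolute_value a.

Lemma abs_ge0 x : 0 <= a x. Proof. by case: aP. Qed.
Lemma abs_eq0 x : (a x == 0) = (x == 0). Proof. by case: aP. Qed.
Lemma absM : {morph a : x y / x * y}. Proof. by case: aP. Qed.
Lemma absD_le x y : a (x + y) <= Num.max (a x) (a y). Proof. by case: aP. Qed.
Lemma abs0 : a 0 = 0. Proof. by apply/eqP; rewrite abs_eq0. Qed.
Lemma abs_gt0 x : (0 < a x) = (x != 0).
Proof. by rewrite lt_def abs_ge0 abs_eq0 andbT. Qed.

Lemma abs1 : a 1 = 1.
Proof.
have a1 : a 1 != 0 by rewrite abs_eq0 oner_neq0.
by apply: (mulfI a1); rewrite -absM !mulr1.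
Qed.

Lemma absN x : a (- x) = a x.
Proof.
suff aN1 : a (- 1) = 1 by rewrite -mulN1r absM aN1 mul1r.
apply/eqP; rewrite -(@eqrXn2 _ 2) ?abs_ge0 // expr1n expr2 -absM mulrNN mulr1.
by rewrite abs1.
Qed.

Lemma absB_le x y : a (x - y) <= Num.max (a x) (a y).
Proof. by rewrite -[a y]absN absD_le. Qed.

Lemma absC x y : a (x - y) = a (y - x).
Proof. by rewrite -absN opprB. Qed.

Lemma absX n x : a (x ^+ n) = a x ^+ n.
Proof. by elim: n => [|n IHn]; rewrite ?abs1 // !exprS absM IHn. Qed.

Lemma absV x : a x^-1 = (a x)^-1.
Proof.
have [->|x0] := eqVneq x 0; first by rewrite invr0 abs0 invr0.
have ax0 : a x != 0 by rewrite abs_eq0.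
by apply: (mulfI ax0); rewrite -absM !mulfV // abs1.
Qed.

Lemma abs_ltD x y e : a x < e -> a y < e -> a (x + y) < e.
Proof. by move=> xe ye; rewrite (le_lt_trans (absD_le x y)) // gt_max xe. Qed.

Lemma abs_leD x y e : a x <= e -> a y <= e -> a (x + y) <= e.
Proof. by move=> xe ye; rewrite (le_trans (absD_le x y)) // ge_max xe. Qed.

Lemma abs_dominant x y : a y < a x -> a (x + y) = a x.
Proof.
move=> yx; apply/eqP; rewrite eq_le abs_leD //; last exact: ltW.
have := absB_le (x + y) y; rewrite addrK le_max => /orP[//|].
by rewrite leNgt yx.
Qed.

Lemma abs_sum_le (I : Type) (r : seq I) (P : pred I) (f : I -> L) e :
  0 <= e -> (forall i, P i -> a (f i) <= e) -> a (\sum_(i <- r | P i) f i) <= e.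
Proof.
move=> e0 fe; apply: (big_ind (fun x => a x <= e)) => //; first by rewrite abs0.
by move=> x y; exact: abs_leD.
Qed.

Lemma abs_sum_lt (I : Type) (r : seq I) (P : pred I) (f : I -> L) e :
  0 < e -> (forall i, P i -> a (f i) < e) -> a (\sum_(i <- r | P i) f i) < e.
Proof.
move=> e0 fe; apply: (big_ind (fun x => a x < e)) => //; first by rewrite abs0.
by move=> x y; exact: abs_ltD.
Qed.

Lemma abs_small_eq0 x : (forall e, 0 < e -> a x < e) -> x = 0.
Proof.
move=> xe; apply/eqP; rewrite -[_ == _]negbK -abs_gt0; apply/negP => /xe.
by rewrite ltxx.
Qed.

Lemma abs_factor1 rho z l : a z <= rho -> rho < a l -> a (1 - z / l) = 1.
Proof.
move=> zr rl; have l0 : 0 < a l.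
  by rewrite (le_lt_trans _ rl) // (le_trans _ zr) ?abs_ge0.
rewrite abs_dominant ?abs1 // absN absM absV ltr_pdivrMr // mul1r.
exact: le_lt_trans rl.
Qed.

(** Each factor moves the product by at most |z|/rho, and in an ultrametric such errors do not
    accumulate. The bound is therefore uniform in S, which is what makes the infinite product
    converge. *)
Lemma abs_prod_far rho z (S : seq L) : 0 < rho -> a z <= rho ->
  {in S, forall l, rho < a l} -> a (\prod_(l <- S) (1 - z / l) - 1) <= a z / rho.
Proof.
move=> r0 zr; have zr1 : a z / rho <= 1 by rewrite ler_pdivrMr // mul1r.
elim: S => [|l S IHS] Sr.
  by rewrite big_nil subrr abs0 divr_ge0 ?abs_ge0 // ltW.
have rl : rho < a l by apply: Sr; rewrite mem_head.
have {}IHS : a (\prod_(k <- S) (1 - z / k) - 1) <= a z / rho.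
  by apply: IHS => k kS; apply: Sr; rewrite inE kS orbT.
rewrite big_cons mulrBl mul1r addrAC; apply: abs_leD => //.
rewrite absN absM absM absV -[leRHS]mulr1.
have l0 : 0 < a l by apply: lt_trans rl.
apply: ler_pM; rewrite ?mulr_ge0 ?invr_ge0 ?abs_ge0 //.
  by rewrite ler_wpM2l ?abs_ge0 // lef_pV2 // ltW.
by rewrite -[X in a X](subrK 1) abs_leD ?abs1 // (le_trans IHS).
Qed.

Lemma abs_prod_eq (S : seq L) z rho : a z <= rho ->
  {in S, forall l, rho < a l} -> a (\prod_(l <- S) (1 - z / l)) = 1.
Proof.
move=> zr; elim: S => [|l S IHS] Sr; first by rewrite big_nil abs1.
rewrite big_cons absM (abs_factor1 zr) ?Sr ?mem_head // mul1r IHS // => k kS.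
by apply: Sr; rewrite inE kS orbT.
Qed.

Lemma abs_lower_bound (S : seq L) : 0 \notin S ->
  exists2 rho, 0 < rho & {in S, forall l, rho < a l}.
Proof.
elim: S => [|l S IHS]; first by exists 1.
rewrite inE negb_or eq_sym => /andP[l0 /IHS[rho r0 rS]].
exists (Num.min rho (a l / 2)); first by rewrite lt_min r0 divr_gt0 ?abs_gt0.
move=> k; rewrite inE gt_min => /orP[/eqP->|/rS->//].
by apply/orP; right; have : 0 < a l; [rewrite abs_gt0 | lra].
Qed.

Lemma poly_tangent (p : {poly L}) : p`_0 = 0 ->
  exists2 c, 0 <= c & forall x, a x <= 1 -> a (p.[x] - p`_1 * x) <= c * a x ^+ 2.
Proof.
move=> p0; pose c := \sum_(i < size p) a p`_i.
have c0 : 0 <= c by apply: sumr_ge0 => i _; exact: abs_ge0.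
exists c => // x x1.
(* Two extra indices let the terms of degree 0 and 1 be split off whatever the size of [p]. *)
have -> : p.[x] - p`_1 * x = \sum_(i < (size p).+2 | (1 < i)%N) p`_i * x ^+ i.
  rewrite (@horner_coef_wide _ (size p).+2) ?leqW // [RHS]big_mkcond /=.
  rewrite !big_ord_recl /= p0 mul0r !add0r [_ + \sum_(_ < _) _]addrC addrK.
  by rewrite /bump /=.
have x2 : 0 <= a x ^+ 2 by rewrite exprn_ge0 ?abs_ge0.
apply: abs_sum_le => [|i i1]; first by rewrite mulr_ge0.
rewrite absM absX; apply: ler_pM; rewrite ?exprn_ge0 ?abs_ge0 //.
  have [lt|ge] := ltnP i (size p); last by rewrite nth_default // abs0.
  by rewrite /c (bigD1 (Ordinal lt)) //= lerDl sumr_ge0 // => k _; exact: abs_ge0.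
by rewrite ler_wiXn2l ?abs_ge0.
Qed.

End AbsoluteValue.

(** * The exponential function of a lattice *)

Section LatticeExponential.
Variables (R : realType) (F : finFieldType) (C : C_infty R F).
Local Notation abs := (@ci_abs R F C).
Implicit Types (Lambda : set C) (rho : R) (z : C).

Lemma ci_absP : absolute_value abs. Proof. exact: (cpl_absP C). Qed.
Local Notation aP := ci_absP.

Definition discrete Lambda :=
  forall rho, finite_set (Lambda `&` [set x | abs x <= rho]).

Definition subgroup Lambda :=
  Lambda 0 /\ forall x y, Lambda x -> Lambda y -> Lambda (x - y).

Definition ball Lambda rho : {fset C} :=
  fset_set (Lambda `&` [set x | abs x <= rho]).

Definition partial_exp (S : {fset C}) z := z * \prod_(l <- S) (1 - z / l).

(** This is the predicate under the [xget] of [exp_lattice], whose value can be used only once a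
    limit is known to exist. *)
Definition exp_limit Lambda z w := forall e, 0 < e -> exists2 S0 : {fset C},
  [set` S0] `<=` Lambda `\ 0 &
  forall S : {fset C}, (S0 `<=` S)%fset -> [set` S] `<=` Lambda `\ 0 ->
    abs (partial_exp S z - w) < e.

Variable Lambda : set C.
Hypotheses (LD : discrete Lambda) (LG : subgroup Lambda).

Lemma in_ball rho x : (x \in ball Lambda rho) <-> Lambda x /\ abs x <= rho.
Proof.
rewrite /ball in_fset_set; last exact: LD.
by split=> [/set_mem|xL]; last exact: mem_set.
Qed.

Definition ball' rho := (ball Lambda rho `\ (0 : C))%fset.

Lemma in_ball' rho x : (x \in ball' rho) <-> [/\ Lambda x, abs x <= rho & x != 0].
Proof.
rewrite !inE; split=> [/andP[x0 /in_ball[? ?]]|[? ? x0]]; first by split.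
by rewrite x0; apply/in_ball.
Qed.

Lemma ball'_sub rho : [set` ball' rho] `<=` Lambda `\ 0.
Proof. by move=> x /= /in_ball'[? _ /eqP ?]; split. Qed.

(** Lattice points outside the ball contribute factors of absolute value 1 whose product is within
    |z|/rho of 1, whatever S is. Products over balls thus control those over all larger finite
    sets. *)
Lemma partial_exp_far rho (S : {fset C}) z : 0 < rho -> abs z <= rho ->
  (ball' rho `<=` S)%fset -> [set` S] `<=` Lambda `\ 0 ->
  abs (partial_exp S z) = abs (partial_exp (ball' rho) z) /\
  abs (partial_exp S z - partial_exp (ball' rho) z)
    <= abs (partial_exp (ball' rho) z) * (abs z / rho).
Proof.
move=> r0 zr BS SL.
have SE : partial_exp S z = partial_exp (ball' rho) z *
    \prod_(l <- (S `\` ball' rho)%fset) (1 - z / l).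
  rewrite /partial_exp -mulrA; congr (_ * _).
  rewrite -big_cat; apply: perm_big; apply: uniq_perm => [||x].
  - exact: fset_uniq.
  - rewrite cat_uniq !fset_uniq andbT; apply/hasPn => x.
    by rewrite in_fsetD => /andP[].
  rewrite mem_cat [X in _ || X]in_fsetD; case: (boolP (x \in ball' rho)) => //= xB.
  by rewrite (fsubsetP BS).
have far : {in (S `\` ball' rho)%fset, forall l, rho < abs l}.
  move=> l; rewrite in_fsetD => /andP[lB lS]; have [lL /= /eqP l0] := SL _ lS.
  by rewrite ltNge; apply: contra lB => lr; apply/in_ball'.
split; first by rewrite SE (absM aP) (abs_prod_eq aP zr far) mulr1.
rewrite SE -[X in _ - X]mulr1 -mulrBr (absM aP).
by rewrite ler_wpM2l ?(abs_ge0 aP) // (abs_prod_far aP).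
Qed.

Lemma ball'_mono rho1 rho2 : rho1 <= rho2 -> (ball' rho1 `<=` ball' rho2)%fset.
Proof.
move=> r12; apply/fsubsetP => x /in_ball'[xL xr x0].
by apply/in_ball'; split=> //; apply: le_trans r12.
Qed.

Lemma exp_limit_exists z : exists w, exp_limit Lambda z w.
Proof.
(* These radii tend to infinity and are at least |z| and positive from the start, as
   [partial_exp_far] requires. *)
pose rho n : R := Num.max 1 (abs z) + n%:R.
have r1 n : 1 <= rho n by rewrite /rho ler_wpDr // le_max lexx.
have rz n : abs z <= rho n by rewrite /rho ler_wpDr // le_max lexx orbT.
have r0 n : 0 < rho n by apply: lt_le_trans (r1 n).
have rm m n : (m <= n)%N -> rho m <= rho n by move=> mn; rewrite lerD2l ler_nat.
pose u n := partial_exp (ball' (rho n)) z.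
(* All [u n] have the absolute value of [u 0], so the error bounds become [c / rho n] with one
   constant. *)
pose c := abs (u 0) * abs z.
have uc n : abs (u n) = abs (u 0).
  by have [] := partial_exp_far (r0 0) (rz 0)
    (ball'_mono (rm _ _ (leq0n n))) (@ball'_sub _).
have close n (S : {fset C}) : (ball' (rho n) `<=` S)%fset ->
    [set` S] `<=` Lambda `\ 0 -> abs (partial_exp S z - u n) <= c / rho n.
  move=> BS SL; have [_] := partial_exp_far (r0 n) (rz n) BS SL.
  by rewrite -/(u n) uc mulrA.
have small e : 0 < e -> exists n, c / rho n < e.
  move=> e0; exists (Num.truncn (c / e)).+1; rewrite ltr_pdivrMr // mulrC.
  have := truncnS_gt (c / e); rewrite ltr_pdivrMr // => lt.
  apply: (lt_le_trans lt); rewrite ler_wpM2r ?(ltW e0) //.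
  by rewrite /rho lerDr le_max ler01.
have cu : abs_cauchy (@cpl_abs _ _ _ C) u.
  move=> e /small[n cn]; exists n => k m nk nm.
  have d i : (n <= i)%N -> abs (u i - u n) < e.
    by move=> ni; apply: le_lt_trans cn; apply: close;
       [exact/ball'_mono/rm | exact: ball'_sub].
  by rewrite -(subrKA (u n)) (abs_ltD aP) ?d // -(absN aP) opprB d.
have [w wP] := cpl_complete cu; exists w => e e0.
have [n cn] := small _ e0; have [N wN] := wP _ e0.
exists (ball' (rho (maxn n N))); first exact: ball'_sub.
move=> S BS SL; rewrite -(subrKA (u (maxn n N))); apply: (abs_ltD aP).
  apply: le_lt_trans (close _ _ BS SL) _; apply: le_lt_trans cn.
  rewrite ler_wpM2l ?mulr_ge0 ?(abs_ge0 aP) // lef_pV2 ?posrE //.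
  by rewrite rm ?leq_maxl.
by apply: wN; rewrite leq_maxr.
Qed.

Local Notation exp := (exp_lattice Lambda).

Lemma exp_latticeP z : exp_limit Lambda z (exp z).
Proof.
have [w wP] := exp_limit_exists z.
exact: (@xgetPex _ 0 [set w | exp_limit Lambda z w] (ex_intro _ w wP)).
Qed.

Lemma exp_near rho z : 0 < rho -> abs z <= rho ->
  abs (exp z - partial_exp (ball' rho) z)
    <= abs (partial_exp (ball' rho) z) * (abs z / rho).
Proof.
move=> r0 zr; rewrite leNgt; apply/negP => lt.
(* The distance itself serves as tolerance in the limit: a finite set containing both S0 and the
   ball contradicts the ultrametric inequality. *)
have e0 : 0 < abs (exp z - partial_exp (ball' rho) z).
  by apply: le_lt_trans lt; rewrite mulr_ge0 ?divr_ge0 ?(abs_ge0 aP) // ltW.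
have [S0 S0L S0P] := exp_latticeP z e0.
pose S := (S0 `|` ball' rho)%fset.
have SL : [set` S] `<=` Lambda `\ 0.
  by move=> x /=; rewrite in_fsetU => /orP[/S0L|/ball'_sub].
have := S0P _ (fsubsetUl _ _) SL.
have [_ far] := partial_exp_far r0 zr (fsubsetUr S0 _) SL.
rewrite (absC aP) => close.
by have := abs_ltD aP close (le_lt_trans far lt); rewrite subrKA ltxx.
Qed.

(** For rho > |z| the error in [exp_near] is the finite product times a factor less than 1. The
    exponential and the finite product hence vanish together, and the zeros of the latter are
    visible. *)
Lemma exp_eq0 z : exp z = 0 <-> Lambda z.
Proof.
pose rho := abs z + 1.
have r0 : 0 < rho by rewrite ltr_wpDl ?(abs_ge0 aP).
have zr : abs z < rho by rewrite ltrDl.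
have near := exp_near r0 (ltW zr).
have PE : partial_exp (ball' rho) z = 0 <-> Lambda z.
  rewrite /partial_exp; split=> [/eqP|zL].
    rewrite mulf_eq0 => /orP[/eqP->|]; first by case: LG.
    rewrite prodf_seq_eq0 => /hasP[l /in_ball'[lL _ l0]] /=.
    by rewrite subr_eq0 eq_sym => /eqP/divr1_eq ->.
  have [->|z0] := eqVneq z 0; first by rewrite mul0r.
  rewrite (big_rem z) /=; first by rewrite divff // subrr mul0r mulr0.
  by apply/in_ball'; split=> //; apply: ltW.
rewrite -PE; split=> [e0|P0].
  apply/eqP; rewrite -(abs_eq0 aP) -[_ == 0]negbK; apply/negP => nz.
  have: abs (partial_exp (ball' rho) z) <=
      abs (partial_exp (ball' rho) z) * (abs z / rho).
    by move: near; rewrite e0 sub0r (absN aP).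
  apply/negP; rewrite -ltNge gtr_pMr; first by rewrite ltr_pdivrMr // mul1r.
  by rewrite lt_def nz (abs_ge0 aP).
apply/eqP; rewrite -(abs_eq0 aP) eq_le (abs_ge0 aP) andbT.
by move: near; rewrite P0 subr0 (abs0 aP) mul0r.
Qed.

Lemma ballB rho : 0 <= rho ->
  {in ball Lambda rho &, forall x y, x - y \in ball Lambda rho}.
Proof.
move=> r0 x y /in_ball[xL xr] /in_ball[yL yr]; apply/in_ball.
by split; [case: LG => _; apply | rewrite (abs_leD aP) // (absN aP)].
Qed.

(** By the ultrametric inequality the lattice points of a ball form a finite subgroup, and the
    partial product is a constant multiple of the monic polynomial with these roots. *)
Lemma partial_expB rho x y : 0 <= rho ->
  partial_exp (ball' rho) (x - y) =
  partial_exp (ball' rho) x - partial_exp (ball' rho) y.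
Proof.
move=> r0; set W := ball Lambda rho.
have W0 : 0 \in W by apply/in_ball; rewrite (abs0 aP); case: LG.
pose c := \prod_(l <- ball' rho) (- l)^-1.
have PE z : partial_exp (ball' rho) z = (\prod_(w <- W) (z - w)) * c.
  rewrite (big_rem 0) //= subr0 /partial_exp -mulrA; congr (_ * _).
  have -> : \prod_(w <- rem 0 W) (z - w) = \prod_(w <- ball' rho) (z - w).
    apply: perm_big; apply: uniq_perm; rewrite ?rem_uniq ?fset_uniq // => w.
    by rewrite mem_rem_uniq ?fset_uniq // !inE.
  rewrite -big_split /=; apply: eq_big_seq => l /in_ball'[_ _ l0].
  by rewrite invrN mulrN mulrBl divff // opprB.
by rewrite !PE -mulrBl -(prod_subgroupB (fset_uniq W) W0 (ballB r0)).
Qed.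

Lemma exp_approx z e : 0 < e ->
  exists rho0, forall rho, rho0 <= rho ->
    abs (exp z - partial_exp (ball' rho) z) < e.
Proof.
move=> e0; have [S0 S0L S0P] := exp_latticeP z e0.
exists (\sum_(l <- S0) abs l) => rho Sr.
rewrite (absC aP); apply: S0P; last exact: ball'_sub.
apply/fsubsetP => l lS; have [lL /eqP l0] := S0L _ lS.
apply/in_ball'; split=> //; apply: le_trans Sr.
by rewrite (big_rem l) //= lerDl sumr_ge0 // => k _; apply: (abs_ge0 aP).
Qed.

Lemma exp_latticeB x y : exp (x - y) = exp x - exp y.
Proof.
apply/eqP; rewrite -subr_eq0; apply/eqP/(abs_small_eq0 aP) => e e0.
have [r1 P1] := exp_approx (x - y) e0.
have [r2 P2] := exp_approx x e0; have [r3 P3] := exp_approx y e0.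
pose rho := Num.max 0 (Num.max r1 (Num.max r2 r3)).
have {}P1 : abs (exp (x - y) - partial_exp (ball' rho) (x - y)) < e.
  by apply: P1; rewrite !le_max lexx !orbT.
have {}P2 : abs (exp x - partial_exp (ball' rho) x) < e.
  by apply: P2; rewrite !le_max lexx !orbT.
have {}P3 : abs (exp y - partial_exp (ball' rho) y) < e.
  by apply: P3; rewrite !le_max lexx !orbT.
move: P1; rewrite partial_expB ?le_max ?lexx // => P1.
set a := partial_exp _ x in P1 P2; set b := partial_exp _ y in P1 P3.
have -> : exp (x - y) - (exp x - exp y) =
  (exp (x - y) - (a - b)) + (- (exp x - a) + (exp y - b)) by ring.
by rewrite (abs_ltD aP) // (abs_ltD aP) // (absN aP).
Qed.

(** If the ball contains no nonzero lattice point, the partial product is z itself and [exp_near]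
    becomes a quadratic bound. *)
Lemma exp_tangent : exists rho, [/\ 0 < rho &
  forall z, abs z <= rho -> abs (exp z - z) <= abs z ^+ 2 / rho].
Proof.
have [|rho r0 rP] := @abs_lower_bound _ _ _ aP (ball' 1).
  by rewrite !inE eqxx.
exists (Num.min rho 1); split=> [|z zr]; first by rewrite lt_min r0 ltr01.
have r'0 : 0 < Num.min rho 1 by rewrite lt_min r0 ltr01.
have := exp_near r'0 zr.
have -> : partial_exp (ball' (Num.min rho 1)) z = z.
  rewrite /partial_exp big1_seq ?mulr1 // => l /andP[_ /in_ball'[lL lr l0]].
  move: lr; rewrite le_min => /andP[lr l1].
  have lB : l \in ball' 1 by apply/in_ball'.
  by have := rP l lB; rewrite ltNge lr.
by rewrite mulrA -expr2.
Qed.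

End LatticeExponential.

(** * Compatibility of normalized isogenies with exponentials *)

Lemma geometric_eq0 (R : realType) (q : nat) (x M : R) : (1 < q)%N -> 0 <= x ->
  (forall k, x * q%:R ^+ k <= M) -> x = 0.
Proof.
move=> q1 x0 xM; apply/eqP; rewrite -[_ == 0]negbK; apply/negP => nz.
have {}x0 : 0 < x by rewrite lt_def nz.
pose k := (Num.truncn (M / x)).+1.
have: M / x < k%:R by exact: truncnS_gt.
rewrite ltr_pdivrMr // mulrC => lt.
have := le_lt_trans (xM k) lt; rewrite ltr_pM2l // -natrX ltr_nat.
by rewrite ltnNge ltnW // ltn_expl.
Qed.

Section IsogenyExponential.
Variables (R : realType) (F : finFieldType) (C : C_infty R F).
Local Notation abs := (@ci_abs R F C).
Local Notation A := (A_emb (ci_emb C)).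
Local Notation q := #|F|.
Let aP := @ci_absP R F C.
Let q_gt1 : (1 < q)%N := finNzRing_gt1 F.

Lemma abs_A (a : {poly F}) : a != 0 -> abs (A a) = q%:R ^+ (size a).-1.
Proof.
move=> a0; rewrite /ci_abs /A_emb /ci_emb /= cpl_absE ci_K0bar_absE cpl_absE.
rewrite /abs_infty tofrac_eq0 (negPf a0) -[a%:F]divr1 -tofrac1.
rewrite ord_inftyE ?oner_neq0 // size_poly1 opprB.
have : (0 < size a)%N by rewrite size_poly_gt0.
by case: (size a) => // n _; rewrite exprnP; congr (_ ^ _); lia.
Qed.

Variables (r : nat) (phi psi : drinfeld (ci_emb C) r) (f : twpoly (ci_emb C)).
Hypotheses (fI : isogeny phi psi f) (f1 : tw_normalized f).
Variables (Lphi Lpsi : set C).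
Hypotheses (DLphi : discrete Lphi) (GLphi : subgroup Lphi).
Hypotheses (DLpsi : discrete Lpsi) (GLpsi : subgroup Lpsi).
Hypothesis ephi :
  forall a z, (qpoly (phi a)).[exp_lattice Lphi z] = exp_lattice Lphi (A a * z).
Hypothesis epsi :
  forall a z, (qpoly (psi a)).[exp_lattice Lpsi z] = exp_lattice Lpsi (A a * z).

Lemma qpoly_tangent (g : twpoly (ci_emb C)) : exists2 c, 0 <= c &
  forall x, abs x <= 1 ->
    abs ((qpoly g).[x] - (tw_poly g)`_0 * x) <= c * abs x ^+ 2.
Proof.
have E : (tw_poly g)`_0 = (qpoly g)`_1.
  have := congr1 (fun p : {poly C} => p`_0) (deriv_qpoly g).
  by rewrite coef_deriv mulr1n coefC eqxx => ->.
by rewrite E; apply: (poly_tangent aP); rewrite -horner_coef0 qpoly0r.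
Qed.

Local Notation d z := ((qpoly f).[exp_lattice Lphi z] - exp_lattice Lpsi z).

Lemma defect_A a z : d (A a * z) = (qpoly (psi a)).[d z].
Proof.
have [_ fE] := fI.
by rewrite qpolyB epsi -ephi -!horner_qpoly_comp fE.
Qed.

Lemma defect_tangent : exists rho c : R, [/\ 0 < rho, 0 <= c &
  forall z, abs z <= rho -> abs (d z) <= c * abs z ^+ 2].
Proof.
have [r1 [r10 P1]] := exp_tangent DLphi.
have [r2 [r20 P2]] := exp_tangent DLpsi.
have [c c0 P3] := qpoly_tangent f.
(* The three summands bound f(u) - u, u - z and w - z, where u and w are the two exponentials at z;
   f(u) is compared with u because f is normalized. *)
exists (Num.min 1 (Num.min r1 r2)), (c + r1^-1 + r2^-1); split.
- by rewrite !lt_min ltr01 r10.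
- by rewrite !addr_ge0 // invr_ge0 ltW.
move=> z; rewrite !le_min => /and3P[z1 zr1 zr2].
have {}P1 := P1 _ zr1; have {}P2 := P2 _ zr2.
have z0 := abs_ge0 aP z.
have ez : abs (exp_lattice Lphi z) <= abs z.
  rewrite -[X in abs X](subrK z) (abs_leD aP) // (le_trans P1) //.
  by rewrite expr2 -mulrA ler_piMr // ler_pdivrMr // mul1r.
have {}P3 := P3 _ (le_trans ez z1).
move: P1 P2 P3; set u := exp_lattice Lphi z; set w := exp_lattice Lpsi z.
rewrite f1 mul1r => P1 P2 P3.
have -> : (qpoly f).[u] - w = ((qpoly f).[u] - u) + ((u - z) - (w - z)) by ring.
have s0 : 0 <= abs z ^+ 2 by rewrite exprn_ge0.
have i1 : 0 <= abs z ^+ 2 / r1 by rewrite mulr_ge0 // invr_ge0 ltW.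
have i2 : 0 <= abs z ^+ 2 / r2 by rewrite mulr_ge0 // invr_ge0 ltW.
have cz : 0 <= c * abs z ^+ 2 by rewrite mulr_ge0.
rewrite !mulrDl [r1^-1 * _]mulrC [r2^-1 * _]mulrC.
apply: (abs_leD aP).
  apply: (le_trans P3); apply: (@le_trans _ _ (c * abs z ^+ 2)); last lra.
  by rewrite ler_wpM2l // lerXn2r ?nnegrE ?(abs_ge0 aP).
apply: (le_trans (absB_le aP _ _)); rewrite ge_max.
by apply/andP; split; [apply: (le_trans P1) | apply: (le_trans P2)]; lra.
Qed.

Lemma exp_isogeny z : (qpoly f).[exp_lattice Lphi z] = exp_lattice Lpsi z.
Proof.
have aT : abs (A 'X) = q%:R by rewrite abs_A ?polyX_eq0 // size_polyX expr1.
have q0 : 0 < q%:R :> R by rewrite ltr0n ltnW.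
have q1 : 1 <= q%:R :> R by rewrite ler1n ltnW.
have T0 : A 'X != 0 by rewrite -(abs_eq0 aP) aT gt_eqF.
have dT x : d x = (qpoly (psi 'X)).[d (x / A 'X)].
  by rewrite -defect_A mulrCA divff // mulr1.
have [c1 c10 P1] := qpoly_tangent (psi 'X).
have [rho [c [rho0 c0 P]]] := defect_tangent.
(* For |x| <= eps the nonlinear part c1 |x|^2 of psi_T(x) is at most q|x|, the size of its linear
   part Tx. The + 1 avoids dividing by zero. *)
pose eps := Num.min 1 (q%:R / (c1 + 1)).
have eps0 : 0 < eps by rewrite lt_min ltr01 divr_gt0 // ltr_wpDl.
have psi_le x : abs x <= eps -> abs (qpoly (psi 'X)).[x] <= q%:R * abs x.
  rewrite le_min => /andP[x1 xq]; rewrite -[X in abs X](subrK (A 'X * x)).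
  apply: (abs_leD aP); last by rewrite (absM aP) aT.
  have {}P1 := P1 _ x1; rewrite drinfeld_const in P1.
  apply: (le_trans P1); rewrite expr2 mulrA ler_wpM2r ?(abs_ge0 aP) //.
  move: xq; rewrite ler_pdivlMr ?ltr_wpDl //.
  by have := abs_ge0 aP x; nra.
(* On this disc the defect is at most eps, so that psi_T may be estimated at its values. *)
pose del := Num.min 1 (Num.min rho (eps / (c + 1))).
have del0 : 0 < del by rewrite !lt_min ltr01 rho0 divr_gt0 // ltr_wpDl.
(* In the induction step |d(x)| <= q |d(x/T)|, and the bound for x/T carries |x|^2 / q^2; one factor
   q is left over for the exponent k + 1. *)
have small k x : abs x <= del -> abs (d x) * q%:R ^+ k <= c * abs x ^+ 2.
  elim: k x => [|k IHk] x xd; first by rewrite mulr1 P //;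
    move: xd; rewrite !le_min => /and3P[].
  have xT : abs (x / A 'X) = abs x / q%:R by rewrite (absM aP) (absV aP) aT.
  have xTd : abs (x / A 'X) <= del.
    by rewrite (le_trans _ xd) // xT ler_pdivrMr // ler_peMr ?(abs_ge0 aP).
  have xe : abs (d (x / A 'X)) <= eps.
    have [y1 yr ye] : [/\ abs (x / A 'X) <= 1, abs (x / A 'X) <= rho &
        abs (x / A 'X) <= eps / (c + 1)].
      by move: xTd; rewrite !le_min => /and3P.
    apply: (le_trans (P _ yr)); move: ye.
    rewrite ler_pdivlMr ?ltr_wpDl //; have := abs_ge0 aP (x / A 'X).
    move: y1; set y := abs _; move=> y1 y0 ye; apply: le_trans ye.
    have : c * y * y <= c * y by rewrite ler_piMr // mulr_ge0.
    by rewrite expr2; lra.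
  have := IHk _ xTd; rewrite xT; have := psi_le _ xe; rewrite -(dT x).
  set u := abs (d x); set w := abs (d (x / _)) => uw H.
  rewrite exprS mulrA; apply: (@le_trans _ _ (q%:R * w * q%:R * q%:R ^+ k)).
    by rewrite ler_wpM2r ?exprn_ge0 ?(ltW q0) // ler_wpM2r ?(ltW q0).
  have -> : q%:R * w * q%:R * q%:R ^+ k = q%:R ^+ 2 * (w * q%:R ^+ k).
    by rewrite expr2; ring.
  rewrite mulrC -ler_pdivlMr ?exprn_gt0 //; apply: (le_trans H).
  by rewrite expr_div_n mulrA.
have d0 x : abs x <= del -> d x = 0.
  move=> xd; apply/eqP; rewrite -(abs_eq0 aP).
  by apply/eqP/(geometric_eq0 q_gt1 (abs_ge0 aP _)) => k; apply: small.
(* The equation d(x) = psi_T(d(x/T)) spreads the vanishing to discs whose radius grows by q each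
   time. *)
have dn n x : abs x <= del * q%:R ^+ n -> d x = 0.
  elim: n x => [|n IHn] x; first by rewrite mulr1; apply: d0.
  move=> xn; rewrite dT IHn ?qpoly0r // (absM aP) (absV aP) aT.
  by rewrite ler_pdivrMr // -mulrA -exprSr.
pose n := (Num.truncn (abs z / del)).+1.
apply/eqP; rewrite -subr_eq0; apply/eqP/(dn n).
have : abs z / del < n%:R by exact: truncnS_gt.
rewrite ltr_pdivrMr // mulrC => /ltW zn; apply: (le_trans zn).
by rewrite ler_wpM2l ?(ltW del0) // -natrX ler_nat ltnW // ltn_expl.
Qed.

End IsogenyExponential.

(** * Successive minimum bases *)

Lemma clear_denominators (A : idomainType) n (v : 'I_n -> {fraction A}) :
  exists2 d : A, d != 0 & exists c : 'I_n -> A, forall i, (c i)%:F = d%:F * v i.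
Proof.
have frac x : exists nd : A * A, nd.2 != 0 /\ x * nd.2%:F = nd.1%:F.
  exists (\n_(repr x), \d_(repr x)); split; first exact: denom_ratioP.
  rewrite /= -{1}[x]reprK; set y := repr x.
  unlock FracField.tofrac; rewrite -[LHS]FracField.pi_mul.
  apply/eqmodP; rewrite /= FracField.equivfE /FracField.mulf.
  by rewrite !numden_Ratio ?oner_neq0 ?mulr1 ?denom_ratioP // mulrC.
have [nd ndP] := choice (fun i => frac (v i)).
exists (\prod_i (nd i).2); first by apply/prodf_neq0 => i _; case: (ndP i).
exists (fun i => (nd i).1 * \prod_(j | j != i) (nd j).2) => i.
have [_ E] := ndP i; rewrite [in RHS](bigD1 i) //= !tofracM -E.
by ring.
Qed.

Lemma row_dependence (K : fieldType) m n (M : 'M[K]_(m, n)) : (n < m)%N ->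
  exists2 v : 'rV[K]_m, v != 0 & v *m M = 0.
Proof.
move=> nm; have : kermx M != 0.
  rewrite -mxrank_eq0 mxrank_ker subn_eq0 -ltnNge.
  exact: leq_ltn_trans (rank_leq_col M) nm.
move=> /eqP kn0; have [i ri] : exists i, row i (kermx M) != 0.
  apply/existsP; apply: contra_notT kn0 => /existsPn r0.
  by apply/row_matrixP => i; rewrite row0; apply/eqP/negPn/r0.
by exists (row i (kermx M)); rewrite // -row_mul mulmx_ker row0.
Qed.

Local Arguments A_emb : simpl never.

Section MinimalBases.
Variables (R : realType) (F : finFieldType) (C : C_infty R F).
Local Notation abs := (@ci_abs R F C).
Local Notation A := (A_emb (ci_emb C)).
Let aP := @ci_absP R F C.

Lemma A_embD : {morph A : x y / x + y}.
Proof. by move=> x y; rewrite /A_emb !rmorphD. Qed.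
Lemma A_embB : {morph A : x y / x - y}.
Proof. by move=> x y; rewrite /A_emb !rmorphB. Qed.
Lemma A_embN : {morph A : x / - x}.
Proof. by move=> x; rewrite /A_emb !rmorphN. Qed.
Lemma A_embM : {morph A : x y / x * y}.
Proof. by move=> x y; rewrite /A_emb !rmorphM. Qed.
Lemma A_emb0 : A 0 = 0. Proof. by rewrite /A_emb !rmorph0. Qed.
Lemma A_emb1 : A 1 = 1. Proof. by rewrite /A_emb !rmorph1. Qed.
Lemma A_emb_eq0 a : (A a == 0) = (a == 0).
Proof. by rewrite /A_emb fmorph_eq0 tofrac_eq0. Qed.

Lemma abs_A_lt (a b : {poly F}) : (size a < size b)%N -> abs (A a) < abs (A b).
Proof.
move=> ab; have b0 : b != 0 by rewrite -size_poly_gt0 (leq_trans _ ab).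
have [->|a0] := eqVneq a 0.
  by rewrite A_emb0 (abs0 aP) (abs_gt0 aP) A_emb_eq0.
rewrite !abs_A // ltr_eXn2l ?ltr1n ?finNzRing_gt1 //.
by move: a0; rewrite -size_poly_gt0; lia.
Qed.

Section Spans.
Variables (n : nat) (b : 'I_n -> C).
Implicit Types P : pred 'I_n.

Lemma A_span0 P : A_span P b 0.
Proof.
exists (fun=> 0); rewrite big1 // => i _.
by rewrite A_emb0 mul0r.
Qed.

Lemma A_spanB P x y : A_span P b x -> A_span P b y -> A_span P b (x - y).
Proof.
move=> [c ->] [c' ->]; exists (fun i => c i - c' i); rewrite -sumrB.
by apply: eq_bigr => i _; rewrite A_embB mulrBl.
Qed.

Lemma A_spanM P a x : A_span P b x -> A_span P b (A a * x).
Proof.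
move=> [c ->]; exists (fun i => a * c i); rewrite mulr_sumr.
by apply: eq_bigr => i _; rewrite A_embM mulrA.
Qed.

Lemma A_span_sub P Q : {subset P <= Q} -> A_span P b `<=` A_span Q b.
Proof.
move=> PQ _ [c ->]; exists (fun i => if P i then c i else 0).
rewrite [RHS](bigID P) /= [X in _ + X]big1 ?addr0 => [|i /andP[_ /negPf->]].
  apply: eq_big => [i|i ->] //.
  by case: (boolP (P i)) => [/PQ|]; rewrite ?andbF ?andbT // => ->.
by rewrite A_emb0 mul0r.
Qed.

End Spans.

Variable Lambda : set C.
Hypothesis LL : A_lattice Lambda.

Lemma lattice_discrete : discrete Lambda.
Proof. by case: LL. Qed.

Lemma lattice_subgroup : subgroup Lambda.
Proof.
case: LL => [[n [b ->]] _]; split; first exact: A_span0.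
by move=> x y; apply: A_spanB.
Qed.

Lemma lattice_stable a x : Lambda x -> Lambda (A a * x).
Proof. by case: LL => [[n [b ->]] _]; apply: A_spanM. Qed.

Lemma lattice_sum (I : Type) (s : seq I) (P : pred I) (f : I -> C) :
  (forall i, P i -> Lambda (f i)) -> Lambda (\sum_(i <- s | P i) f i).
Proof.
have [L0 LB] := lattice_subgroup; move=> fL; apply: big_ind => // x y xL yL.
by rewrite -[y]opprK; apply: (LB) => //; rewrite -sub0r; apply: (LB).
Qed.

(** Compared with [succ_min_basis], the family need not span, so it can be built one vector at a
    time; freeness and the ordering of absolute values follow from the minimality conditions. *)
Definition min_family n (eta : 'I_n -> C) := forall k : 'I_n,
  [/\ Lambda (eta k), ~ A_span (fun j : 'I_n => (k < j)%N) eta (eta k) &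
  forall x, Lambda x -> ~ A_span (fun j : 'I_n => (k < j)%N) eta x ->
    abs (eta k) <= abs x].

(* If cancellation occurred, dividing all later coefficients by that of the
   first term of maximal size would give a shorter vector than [eta k]. *)
Lemma min_family_orthogonal n (eta : 'I_n -> C) (c : 'I_n -> {poly F}) k :
  min_family eta -> abs (A (c k) * eta k) <= abs (\sum_i A (c i) * eta i).
Proof.
move=> etaP; set x := \sum_i _; rewrite leNgt; apply/negP => xk.
pose m i := abs (A (c i) * eta i).
have [k1 _ k1max] := @arg_maxP _ _ _ k xpredT m isT.
pose top i := [forall j, m j <= m i].
have topk1 : top k1 by apply/forallP => j; apply: k1max.
have [l /forallP lmax lmin] := @arg_minnP _ k1 top val topk1.
have lt_m (i : 'I_n) : (i < l)%N -> m i < m l.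
  move=> il; rewrite ltNge; apply/negP => mi; have : top i.
    by apply/forallP => j; apply: le_trans (lmax j) mi.
  by move/lmin; rewrite leqNgt il.
have xl : abs x < m l by apply: lt_le_trans (lmax k).
have ml0 : 0 < m l by apply: le_lt_trans xl; apply: (abs_ge0 aP).
have cl0 : c l != 0.
  by apply: contraTneq ml0 => c0; rewrite /m c0 A_emb0 mul0r (abs0 aP) ltxx.
have Al0 : 0 < abs (A (c l)) by rewrite (abs_gt0 aP) A_emb_eq0.
pose z := \sum_(i < n | (l < i)%N) A (c i %/ c l) * eta i.
have zs : A_span (fun i : 'I_n => (l < i)%N) eta z by exists (fun i => c i %/ c l).
have [lL lns lmin'] := etaP l.
have le_y : abs (eta l) <= abs (eta l + z).
  apply: lmin' => [|ys].
    rewrite -[z]opprK; case: lattice_subgroup => L0 LB; apply: (LB) => //.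
    rewrite -sub0r; apply: LB => //; apply: lattice_sum => i _.
    by apply: lattice_stable; case: (etaP i).
  by apply: lns; rewrite -(addrK z (eta l)); apply: A_spanB.
have : m l <= abs (A (c l) * (eta l + z)).
  by rewrite /m !(absM aP) ler_wpM2l // ltW.
apply/negP; rewrite -ltNge.
(* All three parts on the right are smaller than [m l]: x by assumption, the earlier terms since l
   is the first maximal index, and the remainders since their degree is below that of [c l] while
   the later vectors are no longer than [eta l]. *)
have -> : A (c l) * (eta l + z) = x - \sum_(i < n | (i < l)%N) A (c i) * eta i
    - \sum_(i < n | (l < i)%N) A (c i %% c l) * eta i.
  rewrite /x (bigID (fun i : 'I_n => (i < l)%N)) /=.
  rewrite [X in _ = X - _ - _]addrC addrK.
  rewrite (bigD1 l) ?ltnn //= mulrDr -addrA; congr (_ + _).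
  rewrite (eq_bigl (fun i : 'I_n => (l < i)%N)); last first.
    by move=> i; rewrite -leqNgt ltn_neqAle eq_sym andbC.
  rewrite -sumrB mulr_sumr; apply: eq_bigr => i _.
  by rewrite {2}(divp_eq (c i) (c l)) A_embD A_embM mulrDl addrK mulrA
     [A (c l) * _]mulrC.
do 2?[rewrite (le_lt_trans (absB_le aP _ _)) // gt_max; apply/andP; split] => //.
  by apply: (abs_sum_lt aP) => // i; apply: lt_m.
apply: (abs_sum_lt aP) => // i li; rewrite (absM aP).
have [lt_e|e0] := ltP 0 (abs (eta i)); last first.
  by rewrite (@le_lt_trans _ _ 0) // mulr_ge0_le0 ?(abs_ge0 aP).
rewrite /m (absM aP) (@lt_le_trans _ _ (abs (A (c l)) * abs (eta i))) //.
  by rewrite ltr_pM2r // abs_A_lt // ltn_modp.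
rewrite ler_wpM2l ?(ltW Al0) //; have [_ _ imin] := etaP i.
apply: imin => // s; apply: lns; apply: A_span_sub s => j ij.
exact: ltn_trans ij.
Qed.

Section MinFamily.
Variables (n : nat) (eta : 'I_n -> C).
Hypothesis etaP : min_family eta.

Lemma min_family_neq0 k : eta k != 0.
Proof.
by have [_ ks _] := etaP k; apply: contra_notN ks => /eqP ->; apply: A_span0.
Qed.

Lemma min_family_free : A_free eta.
Proof.
move=> c c0 k; have := min_family_orthogonal c k etaP.
rewrite c0 (abs0 aP) le_eqVlt (ltNge _ 0) (abs_ge0 aP) orbF (abs_eq0 aP).
by rewrite mulf_eq0 (negPf (min_family_neq0 k)) orbF A_emb_eq0 => /eqP.
Qed.

Lemma min_family_mono (i j : 'I_n) : (i <= j)%N -> abs (eta j) <= abs (eta i).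
Proof.
move=> ij; have [iL ins _] := etaP i; have [_ _ jmin] := etaP j.
apply: jmin => // s; apply: ins; apply: A_span_sub s => k jk.
exact: leq_ltn_trans jk.
Qed.

End MinFamily.

Lemma free_notin_span n (b : 'I_n -> C) (P : pred 'I_n) k :
  A_free b -> ~~ P k -> ~ A_span P b (b k).
Proof.
move=> bF Pk [c E].
pose c' i := if i == k then -1 else if P i then c i else 0.
have /bF/(_ k) : \sum_i A (c' i) * b i = 0.
  rewrite (bigD1 k) //= /c' eqxx A_embN A_emb1 mulN1r E addrC; apply/eqP.
  rewrite subr_eq0; apply/eqP; rewrite [RHS]big_mkcond /= [RHS](bigD1 k) //=.
  rewrite (negPf Pk) add0r; apply: eq_bigr => i /negPf ->.
  by case: (P i); rewrite // A_emb0 mul0r.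
by move/eqP; rewrite /c' eqxx oppr_eq0 oner_eq0.
Qed.

Lemma succ_min_basis_min_family n (eta : 'I_n -> C) :
  succ_min_basis Lambda eta -> min_family eta.
Proof.
move=> [[etaF LE] _ etaM] k; split; last exact: etaM.
  rewrite LE; exists (fun i => if i == k then 1 else 0); rewrite (bigD1 k) //= eqxx.
  rewrite A_emb1 mul1r big1 ?addr0 // => i /negPf ->.
  by rewrite A_emb0 mul0r.
by apply: free_notin_span => //; rewrite ltnn.
Qed.

(** Absolute values are real, so the descent runs instead on the number of lattice points of
    absolute value at most |x|, which is finite by discreteness. *)
Lemma exists_shortest (P : set C) x : P `<=` Lambda -> P x ->
  exists2 y, P y & forall z, P z -> abs y <= abs z.
Proof.
move=> PL Px; have [N] : exists N, (#|` ball Lambda (abs x)| < N)%N.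
  by eexists; apply: ltnSn.
elim: N x Px => // N IHN x Px /ltnSE le_N.
have [[z [Pz zx]]|min] := pselect (exists z, P z /\ abs z < abs x); last first.
  exists x => // z Pz; rewrite leNgt; apply/negP => zx; apply: min; by exists z.
apply: (IHN z Pz); apply: leq_trans le_N; apply: fproper_ltn_card.
have LD := lattice_discrete; rewrite fproperE; apply/andP; split.
  apply/fsubsetP => y /(in_ball LD)[yL yz]; apply/(in_ball LD).
  by split=> //; apply: le_trans yz (ltW zx).
apply/negP => /fsubsetP/(_ x) sub.
have /sub/(in_ball LD)[_] : x \in ball Lambda (abs x).
  by apply/(in_ball LD); split=> //; apply: PL.
by rewrite leNgt zx.
Qed.

Definition fcons n x (eta : 'I_n -> C) (i : 'I_n.+1) : C :=
  if unlift ord0 i is Some k then eta k else x.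

Lemma fcons_span n x (eta : 'I_n -> C) (P : pred 'I_n.+1) : ~~ P ord0 ->
  A_span P (fcons x eta) = A_span (fun i => P (lift ord0 i)) eta.
Proof.
move=> P0; apply/seteqP; split=> _ [c ->].
  exists (fun i => c (lift ord0 i)); rewrite big_mkcond big_ord_recl (negPf P0).
  rewrite /= add0r -big_mkcond; apply: eq_bigr => i _.
  by rewrite /fcons liftK.
exists (fun i => if unlift ord0 i is Some k then c k else 0).
rewrite [RHS]big_mkcond big_ord_recl (negPf P0) /= add0r.
rewrite -big_mkcond.
by apply: eq_bigr => i _; rewrite /fcons liftK.
Qed.

(** The family grows at the front: the condition at an index involves only later indices, so a
    shortest vector outside the span can take index 0 without disturbing the others. *)
Lemma min_family_extend n (eta : 'I_n -> C) :
  min_family eta -> A_span xpredT eta <> Lambda ->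
  exists eta' : 'I_n.+1 -> C, min_family eta'.
Proof.
move=> etaP neq; pose P := Lambda `\` A_span xpredT eta.
have [x Px] : exists x, P x.
  apply/not_existsP => nP; apply: neq; apply/seteqP; split=> x xs.
    case: xs => c ->; apply: lattice_sum => i _; apply: lattice_stable.
    by case: (etaP i).
  by have [//|nx] := pselect (A_span xpredT eta x); case: (nP x).
have [|y [yL ys] ymin] := exists_shortest _ Px; first by move=> ? [].
exists (fcons y eta) => k; rewrite fcons_span ?ltnn // => [].
case: (unliftP ord0 k) => [j ->|->]; last first.
  by rewrite /fcons unlift_none; split=> // z zL zs; exact: ymin.
by rewrite /fcons liftK; have [? ? ?] := etaP j; split.
Qed.

(** Since [covolume] admits bases of any length, the length must be tied to the rank. If n < r,
    expressing r free vectors in the basis gives a linear relation over the fraction field, and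
    clearing denominators makes it a relation over the polynomials. *)
Lemma basis_size r n (b : 'I_n -> C) :
  A_rank Lambda r -> A_basis Lambda b -> n = r.
Proof.
move=> [[b' [b'L b'F]] maxr] [bF LE]; apply/eqP; rewrite eqn_leq.
have bL i : Lambda (b i).
  rewrite LE; exists (fun k => if k == i then 1 else 0).
  rewrite (bigD1 i) //= eqxx A_emb1 mul1r big1 ?addr0 // => k /negPf ->.
  by rewrite A_emb0 mul0r.
apply/andP; split.
  rewrite leqNgt; apply/negP => rn.
  apply: (maxr (fun i => b (widen_ord rn i))) => [i|c c0 k]; first exact: bL.
  have /bF/(_ (widen_ord rn k)) :
      \sum_(i < n) A (if insub (val i) is Some l then c l else 0) * b i = 0.
    rewrite (bigID (fun i : 'I_n => (i < r.+1)%N)) /= [X in _ + X]big1 ?addr0.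
      rewrite -[RHS]c0 (big_ord_narrow rn); apply: eq_bigr => i _ /=.
      by rewrite valK.
    by move=> i /negPf ri; rewrite insubF // A_emb0 mul0r.
  by rewrite /= valK.
rewrite leqNgt; apply/negP => nr.
have /choice[c cE] : forall i, exists c : 'I_n -> {poly F},
    b' i = \sum_k A (c k) * b k by move=> i; have := b'L i; rewrite LE.
have [v v0 vM] := row_dependence (\matrix_(i, k) (c i k)%:F) nr.
have [d d0 [u uE]] := clear_denominators (v 0).
case/eqP: v0; apply/rowP => i; rewrite mxE; apply/eqP.
suff /b'F/(_ i) ui : \sum_i A (u i) * b' i = 0.
  have := uE i; rewrite ui tofrac0 => /esym/eqP.
  by rewrite mulf_eq0 tofrac_eq0 (negPf d0).
have -> : \sum_i A (u i) * b' i =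
    A d * \sum_k ci_emb C ((v *m \matrix_(i, k) (c i k)%:F) 0 k) * b k.
  under eq_bigr do rewrite cE mulr_sumr.
  rewrite exchange_big mulr_sumr; apply: eq_bigr => k _.
  rewrite mxE rmorph_sum mulrA mulr_sumr mulr_suml; apply: eq_bigr => l _.
  rewrite mulrA mxE; congr (_ * _).
  by rewrite /A_emb uE !(rmorphM (ci_emb C)) mulrA.
by rewrite vM big1 ?mulr0 // => k _; rewrite mxE rmorph0 mul0r.
Qed.

(** If no minimal family spanned the lattice, extension would never stop and would reach r + 1 free
    vectors. Existence of one basis then makes the [xget] in [covolume] return a genuine product. *)
Lemma covolumeP r : A_rank Lambda r -> exists eta : 'I_r -> C,
  succ_min_basis Lambda eta /\ covolume Lambda = \prod_(i < r) abs (eta i).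
Proof.
move=> Lr; have [n [eta [etaP LE]]] : exists n (eta : 'I_n -> C),
    min_family eta /\ A_span xpredT eta = Lambda.
  apply/notP => no; have ext n : exists eta : 'I_n -> C, min_family eta.
    elim: n => [|n [eta etaP]]; first by exists (fun=> 0) => -[].
    apply: (min_family_extend etaP) => E; apply: no.
    by exists n, eta.
  have [eta etaP] := ext r.+1; case: Lr => _ /(_ eta); apply.
    by move=> i; case: (etaP i).
  exact: min_family_free.
have etaB : succ_min_basis Lambda eta.
  split; first by split=> //; apply: min_family_free.
    exact: min_family_mono.
  by move=> k x xL xs; have [_ _] := etaP k; apply.
pose P := [set d : R | exists r (eta : 'I_r -> C),
  succ_min_basis Lambda eta /\ d = \prod_(i < r) abs (eta i)].
have [r' [eta' [eta'B covE]]] : P (covolume Lambda).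
  by apply: (@xgetPex _ 0 P); exists (\prod_i abs (eta i)), n, eta.
have r'E : r' = r by case: eta'B => LB _ _; apply: basis_size Lr LB.
by subst r'; exists eta'.
Qed.

End MinimalBases.

(** * Counting lattice points *)

(** Hermite's identity: raising m by 1 drops the term m/M from the window and adds (m + M)/M, which
    is larger by exactly 1. *)
Lemma sum_divn_shift M m : (0 < M)%N -> (\sum_(k < M) (m + k) %/ M = m)%N.
Proof.
move=> M0; elim: m => [|m IHm].
  by rewrite big1 // => k _; rewrite add0n divn_small.
case: M M0 IHm => // M _ IHm.
rewrite -[in RHS]IHm big_ord_recr [in RHS]big_ord_recl /= addn0.
rewrite addSnnS divnDr // divnn addn1 addnS addnC; congr (_ + _).+1.
by apply: eq_bigr => k _; rewrite addSnnS.
Qed.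

Lemma ln_prod (R : realType) (I : Type) (s : seq I) (f : I -> R) :
  (forall i, 0 < f i) -> ln (\prod_(i <- s) f i) = \sum_(i <- s) ln (f i).
Proof.
move=> f0; elim: s => [|i s IHs]; first by rewrite !big_nil ln1.
by rewrite !big_cons lnM ?IHs // posrE // prodr_gt0.
Qed.

Lemma bounded_multiples_eq0 (R : realType) (x B : R) :
  (forall M : nat, `|x| * M.+1%:R <= B) -> x = 0.
Proof.
move=> xB; apply/eqP; rewrite -normr_eq0 -[_ == 0]negbK; apply/negP => nz.
have x0 : 0 < `|x| by rewrite lt_def nz normr_ge0.
have : B / `|x| < (Num.truncn (B / `|x|)).+1%:R by exact: truncnS_gt.
by rewrite ltr_pdivrMr // mulrC ltNge xB.
Qed.

Section BallCounting.
Variables (R : realType) (F : finFieldType) (C : C_infty R F).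
Local Notation abs := (@ci_abs R F C).
Local Notation A := (A_emb (ci_emb C)).
Local Notation q := #|F|.
Let aP := @ci_absP R F C.

Definition radius M l : R := q%:R `^ (l%:R / M%:R).

Lemma card_q_gt0 : 0 < q%:R :> R.
Proof. by rewrite ltr0n ltnW ?finNzRing_gt1. Qed.

Lemma ln_q_gt0 : 0 < ln (q%:R : R).
Proof. by rewrite ln_gt0 // ltr1n finNzRing_gt1. Qed.

Lemma radius_gt0 M l : 0 < radius M l.
Proof. exact: powR_gt0 card_q_gt0. Qed.

Lemma radiusD M l k : (0 < M)%N -> radius M (l + k * M) = q%:R ^+ k * radius M l.
Proof.
move=> M0; rewrite /radius natrD mulrDl natrM mulfK ?pnatr_eq0 -?lt0n //.
by rewrite powRD ?(gt_eqF card_q_gt0) ?implybT // mulrC powR_mulrn //.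
Qed.

Section OneLattice.
Variables (Lambda : set C) (r : nat) (eta : 'I_r -> C).
Hypotheses (LL : A_lattice Lambda) (etaB : succ_min_basis Lambda eta).
Let etaM : min_family Lambda eta := succ_min_basis_min_family etaB.

(** By orthogonality a lattice point lies in the ball exactly when each of its terms does, so the
    coefficients range independently over polynomials of bounded size. These are encoded as row
    vectors whose length depends on i. *)
Lemma card_ball rho (n_ : 'I_r -> nat) : 0 <= rho ->
  (forall i a, (abs (A a * eta i) <= rho) = (size a <= n_ i)%N) ->
  #|` ball Lambda rho| = (q ^ (\sum_i n_ i))%N.
Proof.
move=> r0 n_P; have LD := lattice_discrete LL.
have [[etaF LE] _ _] := etaB.
pose T := {dffun forall i : 'I_r, 'rV[F]_(n_ i)}.
pose g (c : T) := \sum_i A (rVpoly (c i)) * eta i.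
have g_inj : injective g.
  move=> c c' /eqP; rewrite -subr_eq0 -sumrB => /eqP E; apply/ffunP => i.
  have /etaF/(_ i)/eqP :
      \sum_i A (rVpoly (c i) - rVpoly (c' i)) * eta i = 0.
    by rewrite -[RHS]E; apply: eq_bigr => k _; rewrite A_embB mulrBl.
  by rewrite subr_eq0 => /eqP/(can_inj (@rVpolyK _ _)).
have E : perm_eq (ball Lambda rho) (map g (enum T)).
  apply: uniq_perm; rewrite ?fset_uniq ?map_inj_uniq -?enumT ?enum_uniq // => x.
  apply/idP/mapP => [/(in_ball LD)[]|[c _ ->]].
    rewrite {1}LE => -[c ->] xr.
    exists [ffun i => poly_rV (c i)]; rewrite ?mem_enum //.
    apply: eq_bigr => i _; rewrite ffunE poly_rV_K // -n_P.
    exact: le_trans (min_family_orthogonal LL c i etaM) xr.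
  apply/(in_ball LD); split; first by rewrite LE; exists (fun i => rVpoly (c i)).
  by apply: (abs_sum_le aP) => // i _; rewrite n_P size_poly.
rewrite (perm_size E) size_map -cardE card_dep_ffun foldrE big_map big_enum /=.
by rewrite expn_sum; apply: eq_bigr => i _; rewrite card_mx mul1n.
Qed.

(** This is the largest integer s with |eta i| <= q^(-s/M). In the ball of radius q^(l/M) the degree
    of the i-th coefficient is then at most (l + s)/M, rounded down, and its size at most one
    more. *)
Definition min_slope (M : nat) i : int :=
  Num.floor (- M%:R * log_q F (abs (eta i))).

Lemma min_slopeP M l k i a : (0 < M)%N -> k%:Z = l%:Z + min_slope M i ->
  (abs (A a * eta i) <= radius M l) = (size a <= (k %/ M).+1)%N.
Proof.
move=> M0 kE; have e0 : 0 < abs (eta i).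
  by rewrite (abs_gt0 aP) (min_family_neq0 etaM).
have [->|a0] := eqVneq a 0.
  by rewrite A_emb0 mul0r (abs0 aP) size_poly0 ltW ?radius_gt0.
have s0 : (0 < size a)%N by rewrite size_poly_gt0.
rewrite (absM aP) abs_A // -(prednK s0) ltnS leq_divRL //.
have q0 := card_q_gt0; have lq := ln_q_gt0.
have M0' : 0 < M%:R :> R by rewrite ltr0n.
rewrite -ler_ln ?posrE ?mulr_gt0 ?exprn_gt0 ?radius_gt0 //.
rewrite lnM ?posrE ?exprn_gt0 // lnXn // ln_powR.
(* As (deg a) M - l is an integer, comparing it with the floor amounts to comparing it with the real
   number - M log_q |eta i|. *)
rewrite -lez_nat kE -lerBlDl floor_ge_int rmorphB /= -!pmulrn natrM.
rewrite -(mulr_natl (ln _)) /log_q; set x := (_.-1)%:R; set ly := ln (abs _).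
rewrite -subr_ge0 -[RHS]subr_ge0.
set D := (X in _ = (0 <= X)).
have -> : l%:R / M%:R * ln q%:R - (x * ln q%:R + ly) = D * (ln q%:R / M%:R).
  by rewrite /D; field; rewrite !gt_eqF.
by rewrite pmulr_lge0 // divr_gt0.
Qed.

Lemma card_ball_radius M l (k : 'I_r -> nat) : (0 < M)%N ->
  (forall i, (k i)%:Z = l%:Z + min_slope M i) ->
  #|` ball Lambda (radius M l)| = (q ^ (\sum_i (k i %/ M).+1))%N.
Proof.
move=> M0 kE; apply: card_ball => [|i a]; first exact/ltW/radius_gt0.
exact: min_slopeP.
Qed.

Lemma min_slope_nat M : exists L, forall l, (L <= l)%N ->
  exists k : 'I_r -> nat, forall i, (k i)%:Z = l%:Z + min_slope M i.
Proof.
exists (\sum_i `|min_slope M i|)%N => l Ll.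
have /choice[k kE] : forall i, exists k : nat, k%:Z = l%:Z + min_slope M i.
  move=> i; have le_i : (`|min_slope M i| <= l)%N.
    by apply: leq_trans Ll; rewrite (bigD1 i) //= leq_addr.
  by exists (absz (l%:Z + min_slope M i)); lia.
by exists k.
Qed.

Lemma card_ball_scale M : (0 < M)%N -> exists L, forall l k, (L <= l)%N ->
  #|` ball Lambda (radius M (l + k * M))| =
    (q ^ (r * k) * #|` ball Lambda (radius M l)|)%N.
Proof.
move=> M0; have [L LP] := min_slope_nat M; exists L => l k /LP[n nE].
rewrite (card_ball_radius M0 nE).
rewrite (@card_ball_radius _ _ (fun i => k * M + n i)%N) // => [|i]; last first.
  by rewrite PoszD nE PoszD addrCA addrA.
rewrite -expnD; congr (_ ^ _)%N.
under eq_bigr do rewrite divnMDl // -addnS.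
by rewrite big_split /= sum_nat_const card_ord.
Qed.

Lemma min_slope_approx M i :
  `|(min_slope M i)%:~R - - M%:R * log_q F (abs (eta i))| <= 1 :> R.
Proof.
set y := - _ * _; have := floor_itv y.
rewrite /min_slope -/y rmorphD /= ler_norml; lra.
Qed.

Lemma log_prod_min_basis :
  log_q F (\prod_i abs (eta i)) = \sum_i log_q F (abs (eta i)).
Proof.
rewrite /log_q ln_prod ?mulr_suml // => i.
by rewrite (abs_gt0 aP) (min_family_neq0 etaM).
Qed.

End OneLattice.

(* Summing [floor (x + k / M)] over [k < M] gives [floor (M x)] up to a constant
   (Hermite), so that the counts for the radii q^(l/M) determine the covolume up
   to an error O(1/M). *)
Lemma covolume_count (Lambda Lambda' : set C) r d :
  A_lattice Lambda -> A_lattice Lambda' -> A_rank Lambda r -> A_rank Lambda' r ->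
  (forall M, (0 < M)%N -> exists L, forall l, (L <= l)%N ->
     #|` ball Lambda' (radius M l)| = (q ^ d * #|` ball Lambda (radius M l)|)%N) ->
  log_q F (covolume Lambda') = log_q F (covolume Lambda) - d%:R.
Proof.
move=> LL LL' Lr Lr' count.
have [eta [etaB ->]] := covolumeP LL Lr.
have [eta' [etaB' ->]] := covolumeP LL' Lr'.
rewrite (log_prod_min_basis etaB) (log_prod_min_basis etaB').
apply/eqP; rewrite -subr_eq0 opprB addrC; apply/eqP.
(* Each of the r vectors in either basis contributes a rounding error of at most 1, whatever M
   is. *)
apply: (@bounded_multiples_eq0 _ _ (r%:R + r%:R)) => m; set M := m.+1.
have slopes : \sum_i min_slope eta' M i = \sum_i min_slope eta M i + (d * M)%:Z.
  have [L0 P0] := count M isT.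
  have [L1 P1] := min_slope_nat eta M; have [L2 P2] := min_slope_nat eta' M.
  pose l := maxn L0 (maxn L1 L2).
  have [k kE] : exists k : 'I_r -> nat,
      forall i, (k i)%:Z = l%:Z + min_slope eta M i.
    by apply: P1; rewrite /l; lia.
  have [k' kE'] : exists k : 'I_r -> nat,
      forall i, (k i)%:Z = l%:Z + min_slope eta' M i.
    by apply: P2; rewrite /l; lia.
  have E j : (\sum_i ((k' i + j) %/ M).+1 = d + \sum_i ((k i + j) %/ M).+1)%N.
    apply/eqP; rewrite -(@eqn_exp2l q) ?finNzRing_gt1 // expnD.
    rewrite -(@card_ball_radius _ _ _ LL etaB M (l + j)
      (fun i => k i + j)%N) // => [|i]; last first.
      by rewrite !PoszD kE addrAC.
    rewrite -(@card_ball_radius _ _ _ LL' etaB' M (l + j)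
      (fun i => k' i + j)%N) // => [|i]; last first.
      by rewrite !PoszD kE' addrAC.
    by rewrite P0 // /l; lia.
  (* The [.+1] that turn degrees into sizes contribute r * M for both lattices and cancel below. *)
  have SE (n : 'I_r -> nat) :
      (\sum_(j < M) \sum_i ((n i + j) %/ M).+1 = \sum_i n i + r * M)%N.
    rewrite exchange_big /=; under eq_bigr => i _.
      under eq_bigr do rewrite -addn1.
      rewrite big_split /= sum_divn_shift // sum_nat_const card_ord muln1; over.
    by rewrite big_split /= sum_nat_const card_ord.
  have : (\sum_i k' i = \sum_i k i + d * M)%N.
    have := SE k'; rewrite (eq_bigr _ (fun (j : 'I_M) _ => E j)).
    rewrite big_split /= sum_nat_const card_ord SE mulnC addnA => /addIn <-.
    by rewrite addnC.
  move/(congr1 Posz); rewrite PoszD !(big_morph Posz PoszD (erefl 0%:Z)).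
  rewrite (eq_bigr _ (fun i _ => kE' i)) (eq_bigr _ (fun i _ => kE i)).
  by rewrite !big_split /= -addrA => /addrI.
have {slopes} := congr1 (fun z : int => z%:~R : R) slopes.
rewrite rmorphD !rmorph_sum /= -pmulrn natrM => slopes.
rewrite -[X in _ * X]ger0_norm ?ler0n // -normrM.
set s := \sum_i log_q F (abs (eta i)); set s' := \sum_i log_q F (abs (eta' i)).
have -> : (d%:R - s + s') * M%:R =
    \sum_i ((min_slope eta' M i)%:~R - - M%:R * log_q F (abs (eta' i))) -
    \sum_i ((min_slope eta M i)%:~R - - M%:R * log_q F (abs (eta i))).
  by rewrite !sumrB slopes -!mulr_sumr -/s -/s'; ring.
have bound (e : 'I_r -> C) :
    `|\sum_i ((min_slope e M i)%:~R - - M%:R * log_q F (abs (e i)))| <= r%:R :> R.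
  apply: (le_trans (ler_norm_sum _ _ _)).
  apply: (le_trans (ler_sum _ (fun i _ => min_slope_approx e M i))).
  by rewrite sumr_const card_ord.
by apply: (le_trans (ler_normB _ _)); rewrite lerD.
Qed.
End BallCounting.

(** * Effect of an isogeny on the covolume *)

Section IsogenyCounting.
Variables (R : realType) (F : finFieldType) (C : C_infty R F).
Local Notation abs := (@ci_abs R F C).
Local Notation A := (A_emb (ci_emb C)).
Local Notation q := #|F|.
Let aP := @ci_absP R F C.

(** The factor [a] lets one statement serve both an isogeny, with a = 1, and its dual. Points x of
    L' are sorted by the value at x/a of the exponential of L: these values are roots of g, and two
    points with the same value differ by a times an element of L. *)
Lemma card_ball_leq (L L' : set C) (g : twpoly (ci_emb C)) (a : C) rho :
  discrete L -> subgroup L -> discrete L' -> subgroup L' -> g != 0 -> a != 0 ->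
  (forall z, (qpoly g).[exp_lattice L z] = exp_lattice L' (a * z)) ->
  (#|` ball L' (abs a * rho)| <= #|` ball L rho| * q ^ (size (tw_poly g)).-1)%N.
Proof.
move=> LD LG LD' LG' g0 a0 gE; set X := ball L' _.
pose h x := exp_lattice L (x / a); pose Y := undup (map h X).
have hY : {in X, forall x, h x \in Y}.
  by move=> x xX; rewrite mem_undup map_f.
have Yq : (size Y <= q ^ (size (tw_poly g)).-1)%N.
  rewrite -ltnS -size_qpoly //.
  apply: max_poly_roots; rewrite ?undup_uniq ?qpoly_neq0 //.
  apply/allP => y; rewrite mem_undup => /mapP[x /(in_ball LD')[xL _] ->].
  by rewrite /root gE mulrC divfK //; apply/eqP/(exp_eq0 LD' LG').
apply: leq_trans (leq_mul (leqnn _) Yq).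
apply: (size_fibers_leq (undup_uniq _) hY) => y.
rewrite mem_undup => /mapP[x0 x0X ->]; rewrite -size_filter.
rewrite -(size_map (fun x => (x - x0) / a)); apply: uniq_leq_size.
  rewrite map_inj_uniq ?filter_uniq ?fset_uniq // => x x' /(divIf a0).
  exact: addIr.
move=> _ /mapP[x + ->]; rewrite mem_filter => /andP[/eqP hx xX].
have [[xL xr] [x0L x0r]] := ((in_ball LD' _ _).1 xX, (in_ball LD' _ _).1 x0X).
apply/(in_ball LD); split.
  by apply/(exp_eq0 LD LG); rewrite mulrBl exp_latticeB // -/(h x) hx subrr.
have a_gt0 : 0 < abs a by rewrite (abs_gt0 aP).
rewrite (absM aP) (absV aP) ler_pdivrMr // [rho * _]mulrC.
by rewrite (abs_leD aP) // (absN aP).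
Qed.

Variables (L : fieldType) (M : closedFieldType).
Variable (kappa : {rmorphism {fraction {poly F}} -> L}).
Variables (iota : {rmorphism L -> C}) (clos : {rmorphism L -> M}).
Hypothesis iotaE : forall x, iota (kappa x) = ci_emb C x.
Variable r : nat.
Implicit Types (phi psi : drinfeld kappa r) (f : twpoly kappa).

Lemma isogeny_covolume phi psi f (Lphi Lpsi : set C) :
  isogeny phi psi f -> tw_normalized f ->
  associated_lattice (base_change iotaE phi) Lphi ->
  associated_lattice (base_change iotaE psi) Lpsi ->
  log_q F (covolume Lpsi) =
    log_q F (covolume Lphi) - ((size (tw_poly f)).-1)%:R.
Proof.
move=> fI f1 [LLphi Rphi Ephi] [LLpsi Rpsi Epsi].
have Dphi := lattice_discrete LLphi; have Gphi := lattice_subgroup LLphi.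
have Dpsi := lattice_discrete LLpsi; have Gpsi := lattice_subgroup LLpsi.
apply: (covolume_count LLphi LLpsi Rphi Rpsi) => N N0.
have [eta [etaB _]] := covolumeP LLphi Rphi.
have [l0 scale] := card_ball_scale LLphi etaB N0.
exists l0 => l l0l; have [nz fE] := fI.
pose f' := tw_map (ci_emb C) iota f.
have f'I : isogeny (base_change iotaE phi) (base_change iotaE psi) f'.
  split=> [|a]; first by rewrite tw_map_eq0.
  by rewrite /= -!rmorphM fE.
have f'1 : tw_normalized f'.
  by rewrite /tw_normalized [LHS]coef_map /= f1 rmorph1.
have fexp := exp_isogeny f'I f'1 Dphi Dpsi Ephi Epsi.
have [a [h [a0 hf]]] := isogeny_dual clos fI f1.
pose h' := tw_map (ci_emb C) iota h.
have hexp z : (qpoly h').[exp_lattice Lpsi z] = exp_lattice Lphi (A a * z).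
  by rewrite -fexp -horner_qpoly_comp -rmorphM -hf -Ephi.
have h0 : h != 0.
  apply: contra_neq a0 => h0; move: hf; rewrite h0 mul0r => phia0.
  apply/eqP/negPn/negP => /(drinfeld_deg phi).
  by rewrite phia0 size_poly0.
have sz : ((size (tw_poly h)).-1 + (size (tw_poly f)).-1 = r * (size a).-1)%N.
  have := drinfeld_deg phi a0; rewrite hf size_tw_mul //.
  have : (0 < size (tw_poly h))%N by rewrite size_poly_gt0.
  have : (0 < size (tw_poly f))%N by rewrite size_poly_gt0.
  lia.
apply/eqP; rewrite eqn_leq; apply/andP; split.
  have fexp1 z : (qpoly f').[exp_lattice Lphi z] = exp_lattice Lpsi (1 * z).
    by rewrite fexp mul1r.
  have := card_ball_leq (radius R F N l) Dphi Gphi Dpsi Gpsi _ (oner_neq0 C) fexp1.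
  by rewrite (abs1 aP) mul1r mulnC size_tw_map; apply; case: f'I.
(* The ball scaled by a holds q^(r deg a) times as many points of [Lphi]. Since r deg a = deg h +
   deg f, cancelling q^(deg h) leaves the missing lower bound. *)
have := card_ball_leq (radius R F N l) Dpsi Gpsi Dphi Gphi _ _ hexp.
rewrite abs_A // -radiusD // scale // -sz expnD -mulnA mulnC size_tw_map.
rewrite leq_pmul2r ?expn_gt0 ?(ltnW (finNzRing_gt1 _)) //.
by apply; rewrite ?tw_map_eq0 // A_emb_eq0.
Qed.

End IsogenyCounting.

(** * The height identity for the four quotients *)

Theorem theorem5p1 (R : realType) (F : finFieldType)
    (K : fieldExtType {fraction {poly F}})
    (Kbar : alg_closure K) (Ksep : sep_closure Kbar)
    (r : nat) (r_gt0 : (0 < r)%N) (phi : drinfeld (in_alg K) r)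
    (G H : set Ksep) (GSG : SG phi G) (HSG : SG phi H)
    (phi_cap phi_sum phi_G phi_H : drinfeld (in_alg K) r)
    (quo_cap : is_quotient phi (G `&` H) phi_cap)
    (quo_sum : is_quotient phi (set_sum G H) phi_sum)
    (quo_G : is_quotient phi G phi_G)
    (quo_H : is_quotient phi H phi_H)
    (v : place K) (v_infinite : infinite_place v)
    (Kv : completion (abs_place R v)) (Cinf : C_infty R F)
    (j : Kv_inclusion Kv Cinf)
    (h_cap h_sum h_G h_H : R)
    (ht_cap : taguchi_height j phi_cap h_cap)
    (ht_sum : taguchi_height j phi_sum h_sum)
    (ht_G : taguchi_height j phi_G h_G)
    (ht_H : taguchi_height j phi_H h_H) :
  h_cap + h_sum = h_G + h_H.
Proof.
have [fc [Ic nc kerc]] := quo_cap; have [fs [Is ns kers]] := quo_sum.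
have [fG [IG nG kerG]] := quo_G; have [fH [IH nH kerH]] := quo_H.
pose deg (f : twpoly (in_alg K)) := (size (tw_poly f)).-1.
have [Lc assc ->] := ht_cap; have [Ls asss ->] := ht_sum.
have [LG assG ->] := ht_G; have [LH assH ->] := ht_H.
have factor X f psi L' :
    isogeny phi psi f -> tw_normalized f ->
    [set y | root (map_poly (ac_emb Kbar) (qpoly f)) y] = sc_incl Ksep @` X ->
    G `&` H `<=` X ->
    associated_lattice (base_change (iota := K_inclusion j) (kvi_K0 j) psi) L' ->
    log_q F (covolume L') = log_q F (covolume Lc) - (deg f)%:R + (deg fc)%:R.
  move=> If nf kerf capX assf.
  have [g fE] : exists g, f = g * fc.
    apply: (tw_kernel_divides (iota := ac_emb Kbar) (tw_normalized_coef0 nc)) => x rx.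
    have [y yX <-] : (sc_incl Ksep @` (G `&` H)) x by rewrite -kerc.
    suff : (sc_incl Ksep @` X) (sc_incl Ksep y) by rewrite -kerf.
    by exists y => //; apply: capX.
  have [Ig ng] := isogeny_factor Ic If nc nf fE.
  rewrite (isogeny_covolume (ac_emb Kbar) Ig ng assc assf) -addrA; congr (_ + _).
  have g0 := tw_normalized_neq0 ng; have fc0 := tw_normalized_neq0 nc.
  have -> : deg f = ((size (tw_poly g)).-1 + deg fc)%N.
    rewrite /deg fE size_tw_mul //.
    have : (0 < size (tw_poly g))%N by rewrite size_poly_gt0.
    have : (0 < size (tw_poly fc))%N by rewrite size_poly_gt0.
    lia.
  by rewrite natrD opprD subrK.
have capG : G `&` H `<=` G by move=> x [].
have capH : G `&` H `<=` H by move=> x [].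
have [rc [uc szc inc]] := tw_kernelP (ac_emb Kbar) (tw_normalized_coef0 nc).
have [rs [us szs ins]] := tw_kernelP (ac_emb Kbar) (tw_normalized_coef0 ns).
have [rG [uG szG inG]] := tw_kernelP (ac_emb Kbar) (tw_normalized_coef0 nG).
have [rH [uH szH inH]] := tw_kernelP (ac_emb Kbar) (tw_normalized_coef0 nH).
have mem (f : twpoly (in_alg K)) X (s : seq Kbar) :
    [set y | root (map_poly (ac_emb Kbar) (qpoly f)) y] = sc_incl Ksep @` X ->
    (forall x, (x \in s) = root (map_poly (ac_emb Kbar) (qpoly f)) x) ->
    forall x, x \in s <-> exists2 y, X y & sc_incl Ksep y = x.
  move=> kerf sE x; rewrite sE.
  rewrite -[X in X <-> _]/([set y |
    root (map_poly (ac_emb Kbar) (qpoly f)) y] x).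
  by rewrite kerf.
have closed (f : twpoly (in_alg K)) (s : seq Kbar) :
    (forall x, (x \in s) = root (map_poly (ac_emb Kbar) (qpoly f)) x) ->
    {in s &, forall x y, x - y \in s}.
  move=> sE x y; rewrite !sE (map_qpoly (ac_emb Kbar \o in_alg K)).
  by rewrite /root qpolyB => /eqP -> /eqP ->; rewrite subr0.
have capE x : x \in rc <-> x \in rG /\ x \in rH.
  rewrite (mem _ _ _ kerc inc) (mem _ _ _ kerG inG) (mem _ _ _ kerH inH).
  split=> [[y [yG yH] <-]|[[y yG <-] [z zH /fmorph_inj zy]]]; first by split; exists y.
  by exists y => //; split=> //; rewrite -zy.
have sumE x : x \in rs <-> exists a b, [/\ a \in rG, b \in rH & x = a + b].
  rewrite (mem _ _ _ kers ins); split=> [[_ [g gG [h hH <-]] <-]|].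
    exists (sc_incl Ksep g), (sc_incl Ksep h); rewrite rmorphD; split=> //.
      by apply/(mem _ _ _ kerG inG); exists g.
    by apply/(mem _ _ _ kerH inH); exists h.
  move=> [_ [_ [/(mem _ _ _ kerG inG)[g gG <-] /(mem _ _ _ kerH inH)[h hH <-] ->]]].
  by exists (g + h); rewrite ?rmorphD //; exists g => //; exists h.
have degE : (deg fc + deg fs = deg fG + deg fH)%N.
  have := size_cap_sum uG uH uc us (closed _ _ inG) (closed _ _ inH) capE sumE.
  rewrite szc szs szG szH -!expnD => /eqP.
  by rewrite eqn_exp2l ?finNzRing_gt1 // => /eqP.
have capS : G `&` H `<=` set_sum G H.
  move=> x [xG xH]; exists x => //; exists 0; last by rewrite addr0.
  (* That H contains 0 is read off from its image, the kernel of [fH]. *)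
  have /(mem _ _ _ kerH inH)[y yH] : 0 \in rH.
    by rewrite inH (map_qpoly (ac_emb Kbar \o in_alg K)) /root qpoly0r.
  by move/eqP; rewrite fmorph_eq0 => /eqP <-.
have cs := factor _ _ _ _ Is ns kers capS asss.
have cG := factor _ _ _ _ IG nG kerG capG assG.
have cH := factor _ _ _ _ IH nH kerH capH assH.
have hE (L : set Cinf) :
  log_q F (covolume L `^ (- (1 / r%:R))) = - (1 / r%:R) * log_q F (covolume L).
  by rewrite /log_q ln_powR mulrA.
rewrite !hE cs cG cH.
have := congr1 (fun n => n%:R : R) degE; rewrite !natrD => E.
by rewrite -!mulrDr; congr (_ * _); lra.
Qed.
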